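(* Let $S=K[[x_1,\ldots,x_n]]$, where $K$ is a field. Let $f_1,\ldots,f_\ell\in S$ be irreducible, and $f=f_1^{\alpha_1}\cdots f_\ell^{\alpha_\ell}$, where each $\alpha_i\in\mathbb{N}$. Then $$\lambda^{n-1}_0(S/f)\ge\lambda^{n-1}_0(S/f_1)+\cdots+\lambda^{n-1}_0(S/f_\ell)+\ell-1.$$
   Context: For a local ring $(A,m,K)$ containing a field, choose a surjective ring map $\pi:T=K[[y_1,\ldots,y_r]]\twoheadrightarrow\widehat{A}$ (for some $r\in\mathbb{N}$) onto the completion of $A$ at $m$. The generalized Lyubeznik number of $A$ with respect to the zero ideal and $i\in\mathbb{N}$ is $\lambda^i_0(A):=\operatorname{length}_{D(T,K)}H^{r-i}_{\operatorname{Ker}\pi}(T)$, where $D(T,K)$ is the ring of $K$-linear differential operators of $T$ and local cohomology modules of $T$ carry their natural $D(T,K)$-module structure. This length is finite and independent of the choice of $T$ and $\pi$. For $g\in S$, $S/g$ means $S/gS$; in particular, for a nonzero nonunit $g\in S$, $\lambda^{n-1}_0(S/g)=\operatorname{length}_{D(S,K)}H^1_{gS}(S)$.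
   Formalization: The irreducible f_1,…,f_ℓ are assumed pairwise non-associated, with ℓ ≥ 1 and each α_i ≥ 1; otherwise the inequality fails (e.g. f_1 = f_2 = x in K[[x]], f = x², gives 1 ≥ 3). *)

(* Defs.v *)
From HB Require Import structures.
From mathcomp Require Import all_boot all_order all_algebra.
From mathcomp Require Import fraction ring_quotient.
From mathcomp Require Import mpoly.
From mathcomp Require Import boolp constructive_ereal.
From mathcomp Require Import ring.

Set Implicit Arguments.
Unset Strict Implicit.
Unset Printing Implicit Defensive.

Import Order.TTheory GRing.Theory Num.Theory.

Local Open Scope ring_scope.

(* K[[x_1, ..., x_n]]: a power series is its family of coefficients. *)
Definition mpseries (K : fieldType) (n : nat) : Type := 'X_{1..n} -> K.

HB.instance Definition _ (K : fieldType) (n : nat) :=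
  gen_eqMixin (mpseries K n).
HB.instance Definition _ (K : fieldType) (n : nat) :=
  gen_choiceMixin (mpseries K n).

Section PowerSeries.
Variables (K : fieldType) (n : nat).
Local Notation S := (mpseries K n).
Implicit Types (f g h : S) (m : 'X_{1..n}).

Definition mps_zero : S := fun=> 0.
Definition mps_opp f : S := fun m => - f m.
Definition mps_add f g : S := fun m => f m + g m.
Definition mps_one : S := fun m => (m == 0%MM)%:R.
Definition mps_scale (c : K) f : S := fun m => c * f m.

(* Cauchy product; the summation range matches [mcoeffM] for polynomials. *)
Definition mps_mul f g : S := fun m =>
  \sum_(k : 'X_{1..n < (mdeg m).+1, (mdeg m).+1} | m == (k.1 + k.2)%MM)
    f k.1 * g k.2.

Fact mps_addA : associative mps_add.
Proof. by move=> f g h; apply/funext => m; exact: addrA. Qed.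
Fact mps_addC : commutative mps_add.
Proof. by move=> f g; apply/funext => m; exact: addrC. Qed.
Fact mps_add0 : left_id mps_zero mps_add.
Proof. by move=> f; apply/funext => m; exact: add0r. Qed.
Fact mps_addN : left_inverse mps_zero mps_opp mps_add.
Proof. by move=> f; apply/funext => m; exact: addNr. Qed.

HB.instance Definition _ :=
  GRing.isZmodule.Build S mps_addA mps_addC mps_add0 mps_addN.

Definition mps_trunc d f : {mpoly K[n]} :=
  \sum_(m : 'X_{1..n < d}) f m *: 'X_[m].

Lemma mps_truncE d f m : (mdeg m < d)%N -> (mps_trunc d f)@_m = f m.
Proof. exact: mcoeff_mpoly. Qed.

Lemma mps_mul_trunc d f g (p q : {mpoly K[n]}) :
    (forall m, (mdeg m < d)%N -> p@_m = f m) ->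
    (forall m, (mdeg m < d)%N -> q@_m = g m) ->
  forall m, (mdeg m < d)%N -> (p * q)@_m = mps_mul f g m.
Proof.
move=> pf qg m md; rewrite mcoeffM; apply: eq_bigr => -[k1 k2] _ /=.
by rewrite pf ?qg //; [case: k2|case: k1] => k /= kd; apply: leq_trans kd md.
Qed.

Fact mps_mulA : associative mps_mul.
Proof.
move=> f g h; apply/funext => m; set d := (mdeg m).+1.
have T u := @mps_truncE d u.
rewrite -(mps_mul_trunc (T f) (mps_mul_trunc (T g) (T h))) //.
by rewrite mulrA (mps_mul_trunc (mps_mul_trunc (T f) (T g)) (T h)).
Qed.

Fact mps_mulC : commutative mps_mul.
Proof.
move=> f g; apply/funext => m; set d := (mdeg m).+1.
have T u := @mps_truncE d u.
by rewrite -(mps_mul_trunc (T f) (T g)) // mulrC (mps_mul_trunc (T g) (T f)).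
Qed.

Fact mps_mul1 : left_id mps_one mps_mul.
Proof.
move=> f; apply/funext => m; set d := (mdeg m).+1.
have T u := @mps_truncE d u.
have T1 k : (mdeg k < d)%N -> (1 : {mpoly K[n]})@_k = mps_one k.
  by rewrite mcoeff1.
by rewrite -(mps_mul_trunc T1 (T f)) // mul1r T.
Qed.

Fact mps_mulDl : left_distributive mps_mul +%R.
Proof.
move=> f g h; apply/funext => m.
rewrite -[RHS]/(mps_mul f h m + mps_mul g h m) /mps_mul -big_split /=.
by apply: eq_bigr => k _; rewrite mulrDl.
Qed.

Fact mps_one_neq0 : mps_one != 0.
Proof.
apply/eqP => /(congr1 (fun f : S => f 0%MM)).
by rewrite /mps_one eqxx => /eqP; rewrite oner_eq0.
Qed.

HB.instance Definition _ := GRing.Zmodule_isComNzRing.Build S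
  mps_mulA mps_mulC mps_mul1 mps_mulDl mps_one_neq0.

Fact mps_scaleA a b f : mps_scale a (mps_scale b f) = mps_scale (a * b) f.
Proof. by apply/funext => m; exact: mulrA. Qed.
Fact mps_scale1 : left_id 1 mps_scale.
Proof. by move=> f; apply/funext => m; exact: mul1r. Qed.
Fact mps_scaleDr : right_distributive mps_scale +%R.
Proof. by move=> a f g; apply/funext => m; exact: mulrDr. Qed.
Fact mps_scaleDl f : {morph mps_scale^~ f : a b / a + b}.
Proof. by move=> a b; apply/funext => m; exact: mulrDl. Qed.

HB.instance Definition _ := GRing.Zmodule_isLmodule.Build K S
  mps_scaleA mps_scale1 mps_scaleDr mps_scaleDl.

Fact mps_scaleAl (a : K) f g : a *: (f * g) = (a *: f) * g.
Proof.
apply/funext => m.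
rewrite [LHS]mulr_sumr; apply: eq_bigr => k _; exact: mulrA.
Qed.

HB.instance Definition _ := GRing.Lmodule_isLalgebra.Build K S mps_scaleAl.
HB.instance Definition _ := GRing.Lalgebra_isComAlgebra.Build K S.

Definition mps_unit : pred S := fun f => `[< exists g, g * f = 1 >].
Definition mps_inv f : S :=
  if pselect (exists g, g * f = 1) is left fV then sval (cid fV) else f.

Fact mps_mulVf : {in mps_unit, left_inverse 1 mps_inv *%R}.
Proof.
move=> f /asboolP fV; rewrite /mps_inv.
by case: pselect => // fV'; case: cid.
Qed.
Fact mps_unitPl f g : g * f = 1 -> mps_unit f.
Proof. by move=> gf; apply/asboolP; exists g. Qed.
Fact mps_inv_out : {in [predC mps_unit], mps_inv =1 id}.
Proof.
move=> f /negP fNV; rewrite /mps_inv.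
by case: pselect => // fV; case: fNV; apply/asboolP.
Qed.

HB.instance Definition _ := GRing.ComNzRing_hasMulInverse.Build S
  mps_mulVf mps_unitPl mps_inv_out.

Lemma mps_min f : f != 0 ->
  exists2 m, f m != 0 & forall k, f k != 0 -> (m <= k)%O.
Proof.
move=> f0; suff [m fm] : exists m, f m != 0.
  elim/(ltmwf (n := n)): m fm => m IH fm.
  have [[k fk km]|H] := pselect (exists2 k, f k != 0 & (k < m)%O).
    exact: IH km fk.
  exists m => // k fk; rewrite leNgt; apply/negP => km.
  by apply: H; exists k.
apply: contrapT => H; case/eqP: f0; apply/funext => m.
by apply/eqP/negP => /negP fm; apply: H; exists m.
Qed.

Fact mps_mulf_eq0 f g : f * g = 0 -> (f == 0) || (g == 0).
Proof.
move=> fg0; apply/contraT; rewrite negb_or => /andP[/mps_min[a fa Ha]].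
move=> /mps_min[b gb Hb].
have /(congr1 (fun u : S => u (a + b)%MM)) := fg0.
rewrite [LHS]/(mps_mul f g _) [RHS]/(0 : K) /mps_mul.
have ad : (mdeg a < (mdeg (a + b)).+1)%N by rewrite mdegD ltnS leq_addr.
have bd : (mdeg b < (mdeg (a + b)).+1)%N by rewrite mdegD ltnS leq_addl.
rewrite (bigD1 (BMultinom ad, BMultinom bd)) //= big1 ?addr0.
  by move/eqP; rewrite mulf_eq0 (negbTE fa) (negbTE gb).
move=> [[k1 k1d] [k2 k2d]] /= /andP[/eqP abk kN]; apply/eqP.
rewrite mulf_eq0; apply/contraT; rewrite negb_or => /andP[fk1 gk2].
have [ak bk] := (Ha _ fk1, Hb _ gk2).
case/negP: kN; apply/eqP; congr pair; apply/val_inj => /=.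
  case: ltgtP ak => // ak _; have := ltmc_le_add ak bk.
  by rewrite abk ltxx.
case: ltgtP bk => // bk _; have := lemc_lt_add ak bk.
by rewrite abk ltxx.
Qed.

HB.instance Definition _ :=
  GRing.ComUnitRing_isIntegral.Build S mps_mulf_eq0.

End PowerSeries.

(* Grothendieck's filtration: [order_lt d P] says that P has order < d, where
   0 is the only operator of negative order and P has order < d.+1 when all
   the commutators [P, a] have order < d. *)
Fixpoint order_lt (R : comNzRingType) (d : nat) (P : R -> R) : Prop :=
  if d is d'.+1 then forall a, order_lt d' (fun x => P (a * x) - a * P x)
  else forall x, P x = 0.

Section OrderTheory.
Variable R : comNzRingType.
Implicit Types (P Q : R -> R) (d e : nat).

Lemma eq_order_lt d P Q : P =1 Q -> order_lt d P -> order_lt d Q.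
Proof. by move=> /funext ->. Qed.

Lemma order_lt_0 d : order_lt d (fun=> 0 : R).
Proof.
elim: d => //= d IH a; apply: eq_order_lt IH => x.
by rewrite mulr0 subr0.
Qed.

Lemma order_ltS d P : order_lt d P -> order_lt d.+1 P.
Proof.
elim: d P => [|d IH] P HP a; last exact: IH (HP a).
by move=> x; rewrite !HP mulr0 subr0.
Qed.

Lemma order_ltW d e P : (d <= e)%N -> order_lt d P -> order_lt e P.
Proof.
by move=> /subnK <-; elim: (e - d)%N => // k IH HP; apply/order_ltS/IH.
Qed.

Lemma order_ltB d P Q :
  order_lt d P -> order_lt d Q -> order_lt d (fun x => P x - Q x).
Proof.
elim: d P Q => [|d IH] P Q HP HQ; first by move=> x; rewrite HP HQ subr0.
move=> a; apply: eq_order_lt (IH _ _ (HP a) (HQ a)) => x /=.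
by ring.
Qed.

Lemma order_lt_mul d P (b : R) :
  order_lt d P -> order_lt d (fun x => b * P x).
Proof.
elim: d P => [|d IH] P HP; first by move=> x; rewrite HP mulr0.
move=> a; apply: eq_order_lt (IH _ (HP a)) => x /=.
by rewrite mulrBr (mulrCA b).
Qed.

Lemma order_lt_comp_mul d P (b : R) :
  order_lt d P -> order_lt d (fun x => P (b * x)).
Proof.
elim: d P => [|d IH] P HP; first by move=> x; rewrite HP.
move=> a; apply: eq_order_lt (IH _ (HP a)) => x /=.
by rewrite (mulrCA b).
Qed.

Lemma order_lt_comp d e P Q : zmod_morphism P ->
  order_lt d P -> order_lt e Q -> order_lt (d + e) (P \o Q).
Proof.
move: {2}(d + e)%N (leqnn (d + e)) => N.
elim: N d e P Q => [|N IH] d e P Q dN PB.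
  move: dN; rewrite leqn0 addn_eq0 => /andP[/eqP -> /eqP ->] HP HQ x /=.
  exact: HP.
have P0 : P 0 = 0 by have := PB 0 0; rewrite !subrr.
case: d dN => [_ HP _|d dN HP].
  by apply: (eq_order_lt _ (order_lt_0 _)) => x /=; rewrite HP.
case: e dN => [_ HQ|e dN HQ].
  by apply: (eq_order_lt _ (order_lt_0 _)) => x /=; rewrite HQ P0.
rewrite addSn => a /=.
have dN1 : (d + e.+1 <= N)%N by rewrite -ltnS -addSn.
have dN2 : (d.+1 + e <= N)%N by rewrite addSn -addnS.
have H2 := IH _ _ _ _ dN2 PB HP (HQ a).
have H1 : order_lt (d + e.+1)%N ((fun x => P (a * x) - a * P x) \o Q).
  apply: (IH _ _ _ _ dN1) (HP a) HQ => x y.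
  by rewrite mulrBr !PB; ring.
have H3 : order_lt (d + e.+1)%N (fun x => 0 - (P \o (fun x => Q (a * x) - a * Q x)) x).
  by apply: order_ltB (order_lt_0 _) _; rewrite addnS -addSn.
apply: eq_order_lt (order_ltB H1 H3) => x /=.
by rewrite PB; ring.
Qed.

End OrderTheory.

(* The ring D(A, K) of K-linear differential operators of A; its product is
   the composition. *)
Definition is_diffop (K : fieldType) (A : comAlgType K) (P : A -> A) : Prop :=
  linear P /\ exists d, order_lt d P.

Record diffop (K : fieldType) (A : comAlgType K) := Diffop {
  diffop_fun :> A -> A;
  _ : `[< is_diffop diffop_fun >] }.

HB.instance Definition _ (K : fieldType) (A : comAlgType K) :=
  [isSub for @diffop_fun K A].
HB.instance Definition _ (K : fieldType) (A : comAlgType K) :=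
  gen_eqMixin (diffop A).
HB.instance Definition _ (K : fieldType) (A : comAlgType K) :=
  gen_choiceMixin (diffop A).

Section DiffopRing.
Variables (K : fieldType) (A : comAlgType K).
Implicit Types P Q T : diffop A.

Lemma diffopP P : is_diffop P.
Proof. by case: P => P /= /asboolP. Qed.

Lemma diffopB P : zmod_morphism P.
Proof.
move=> x y; have [lP _] := diffopP P.
by rewrite -scaleN1r addrC lP scaleN1r addrC.
Qed.

Lemma diffop_ext P Q : P =1 Q -> P = Q.
Proof. by move=> PQ; apply/val_inj/funext. Qed.

Fact diffop_zero_proof : is_diffop (fun=> 0 : A).
Proof. by split; [move=> a x y; rewrite scaler0 addr0|exists 0%N]. Qed.
Definition diffop_zero := Diffop (asboolT diffop_zero_proof).

Fact diffop_sub_proof P Q : is_diffop (fun x => P x - Q x).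
Proof.
have [lP [d HP]] := diffopP P; have [lQ [e HQ]] := diffopP Q; split.
  by move=> a x y; rewrite lP lQ scalerBr opprD addrACA.
exists (maxn d e); apply: order_ltB.
  exact: order_ltW (leq_maxl _ _) HP.
exact: order_ltW (leq_maxr _ _) HQ.
Qed.
Definition diffop_sub P Q := Diffop (asboolT (diffop_sub_proof P Q)).
Definition diffop_opp P := diffop_sub diffop_zero P.
Definition diffop_add P Q := diffop_sub P (diffop_opp Q).

Lemma diffop_oppE P x : diffop_opp P x = - P x.
Proof. exact: sub0r. Qed.
Lemma diffop_addE P Q x : diffop_add P Q x = P x + Q x.
Proof. by rewrite /= sub0r opprK. Qed.

Fact diffop_addA : associative diffop_add.
Proof. by move=> P Q T; apply: diffop_ext => x; rewrite !diffop_addE addrA. Qed.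
Fact diffop_addC : commutative diffop_add.
Proof. by move=> P Q; apply: diffop_ext => x; rewrite !diffop_addE addrC. Qed.
Fact diffop_add0 : left_id diffop_zero diffop_add.
Proof. by move=> P; apply: diffop_ext => x; rewrite !diffop_addE add0r. Qed.
Fact diffop_addN : left_inverse diffop_zero diffop_opp diffop_add.
Proof.
by move=> P; apply: diffop_ext => x; rewrite diffop_addE diffop_oppE addNr.
Qed.

HB.instance Definition _ := GRing.isZmodule.Build (diffop A)
  diffop_addA diffop_addC diffop_add0 diffop_addN.

Fact diffop_one_proof : is_diffop (id : A -> A).
Proof. by split=> //; exists 1%N => a x; rewrite subrr. Qed.
Definition diffop_one := Diffop (asboolT diffop_one_proof).

Fact diffop_mul_proof P Q : is_diffop (P \o Q).
Proof.
have [lP [d HP]] := diffopP P; have [lQ [e HQ]] := diffopP Q; split.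
  by move=> a x y; rewrite /= lQ lP.
by exists (d + e)%N; apply: order_lt_comp HP HQ; apply: diffopB.
Qed.
Definition diffop_mul P Q := Diffop (asboolT (diffop_mul_proof P Q)).

Fact diffop_mulA : associative diffop_mul.
Proof. by move=> P Q T; apply: diffop_ext. Qed.
Fact diffop_mul1l : left_id diffop_one diffop_mul.
Proof. by move=> P; apply: diffop_ext. Qed.
Fact diffop_mul1r : right_id diffop_one diffop_mul.
Proof. by move=> P; apply: diffop_ext. Qed.
Fact diffop_mulDl : left_distributive diffop_mul +%R.
Proof. by move=> P Q T; apply: diffop_ext => x; rewrite [RHS]diffop_addE
  -[LHS]/(diffop_add P Q (T x)) diffop_addE. Qed.
Fact diffop_mulDr : right_distributive diffop_mul +%R.
Proof.
move=> P Q T; apply: diffop_ext => x; rewrite [RHS]diffop_addE.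
rewrite -[LHS]/(P (diffop_add Q T x)) diffop_addE.
by have [lP _] := diffopP P; rewrite -[Q x]scale1r lP scale1r.
Qed.
Fact diffop_one_neq0 : diffop_one != 0.
Proof.
apply/eqP => /(congr1 (fun P : diffop A => P 1)).
by move/eqP; rewrite oner_eq0.
Qed.

HB.instance Definition _ := GRing.Zmodule_isNzRing.Build (diffop A)
  diffop_mulA diffop_mul1l diffop_mul1r diffop_mulDl diffop_mulDr
  diffop_one_neq0.

End DiffopRing.

Section FractionExtension.
Variable R : idomainType.
Local Notation F := {fraction R}.
Local Notation "x %:F" := (@tofrac R x).

Lemma fracP (y : F) : exists a b : R, b != 0 /\ y = a%:F / b%:F.
Proof.
elim/quotW: y => x; exists (frac x).1, (frac x).2; split; first exact: denom_ratioP.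
apply: (canRL (mulfK _)); first by rewrite tofrac_eq0 denom_ratioP.
unlock FracField.tofrac; rewrite -[LHS]FracField.pi_mul; apply/eqmodP => /=.
rewrite FracField.equivfE /FracField.mulf !numden_Ratio ?oner_neq0 //.
  by rewrite !mulr1 mulrC.
all: by rewrite mulr1 denom_ratioP.
Qed.

(* A differential operator on the fraction field is determined by its
   restriction to the ring. *)
Lemma fracext_uniq d e (E1 E2 : F -> F) :
    order_lt d E1 -> order_lt e E2 -> (forall x : R, E1 x%:F = E2 x%:F) ->
  E1 =1 E2.
Proof.
move=> H1 H2 E12.
pose G y := E1 y - E2 y.
have G0 x : G x%:F = 0 by rewrite /G E12 subrr.
have: order_lt (maxn d e) G.
  apply: order_ltB; first exact: order_ltW (leq_maxl _ _) H1.
  exact: order_ltW (leq_maxr _ _) H2.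
move: (maxn d e) => k HG y; apply/eqP; rewrite -subr_eq0 -/(G y); apply/eqP.
move: {E1 E2 H1 H2 E12} G HG G0 y.
elim: k => [|k IH] G HG G0 y; first exact: HG.
have [a [b [b0 ->]]] := fracP y.
have GI x : G (b%:F * x%:F) - b%:F * G x%:F = 0.
  by rewrite -tofracM !G0 mulr0 subr0.
have /eqP := IH _ (HG b%:F) GI (a%:F / b%:F).
rewrite mulrCA divff ?tofrac_eq0 // mulr1 G0 sub0r oppr_eq0 mulf_eq0.
by rewrite tofrac_eq0 (negbTE b0) => /eqP.
Qed.

Definition is_fracext (P : R -> R) (E : F -> F) : Prop :=
  [/\ zmod_morphism E, exists d, order_lt d E & forall x, E x%:F = (P x)%:F].

Lemma is_fracext_uniq P E1 E2 : is_fracext P E1 -> is_fracext P E2 -> E1 = E2.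
Proof.
move=> [_ [d H1] P1] [_ [e H2] P2]; apply/funext.
by apply: fracext_uniq H1 H2 _ => x; rewrite P1 P2.
Qed.

Lemma fracext_exists d (P : R -> R) : zmod_morphism P -> order_lt d P ->
  exists E : F -> F,
    [/\ zmod_morphism E, order_lt d E & forall x, E x%:F = (P x)%:F].
Proof.
elim: d P => [|d IH] P PB HP.
  exists (fun=> 0); split=> // [x y|x]; first by rewrite subrr.
  by rewrite HP tofrac0.
have comB a : zmod_morphism (fun x => P (a * x) - a * P x).
  by move=> x y; rewrite mulrBr !PB; ring.
have [E_ HE] := choice (fun a => IH _ (comB a) (HP a)).
have EB a : zmod_morphism (E_ a) by case: (HE a).
have Ed a : order_lt d (E_ a) by case: (HE a).
have EP a x : E_ a x%:F = (P (a * x))%:F - a%:F * (P x)%:F.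
  by case: (HE a) => _ _ ->; rewrite tofracB tofracM.
have Ecom a b y : E_ (a * b) y = E_ a (b%:F * y) + a%:F * E_ b y.
  apply/eqP; rewrite -subr_eq; apply/eqP; move: y.
  apply: (@fracext_uniq d d); first by apply/order_ltB/order_lt_mul.
    exact: order_lt_comp_mul.
  by move=> x; rewrite -tofracM !EP !tofracM -mulrA; ring.
have subeq (u v x y : F) : u = v -> x - y = u - v -> x = y.
  by move=> ->; rewrite subrr => /eqP; rewrite subr_eq0 => /eqP.
have Esym a b y :
    E_ a (b%:F * y) + a%:F * E_ b y = E_ b (a%:F * y) + b%:F * E_ a y.
  by rewrite -!Ecom mulrC.
have [nm Hnm] := choice fracP; have [dn Hdn] := choice Hnm.
pose E y := ((P (nm y))%:F - E_ (dn y) y) / (dn y)%:F.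
have EE a b y : b != 0 -> b%:F * y = a%:F ->
    b%:F * E y = (P a)%:F - E_ b y.
  move=> b0 yE; rewrite /E; have [] := Hdn y.
  move: (nm y) (dn y) => n c c0 ynE.
  have {}ynE : c%:F * y = n%:F by rewrite ynE mulrCA divff ?mulr1 ?tofrac_eq0.
  have bn : b * n = c * a.
    by apply/eqP; rewrite -tofrac_eq !tofracM -ynE -yE mulrCA.
  have := Esym b c y; rewrite yE ynE !EP bn => H.
  apply: (mulfI (_ : c%:F != 0)); first by rewrite tofrac_eq0.
  rewrite mulrCA [c%:F * (_ / _)]mulrC divfK ?tofrac_eq0 //.
  by apply: (subeq _ _ _ _ (esym H)); ring.
have bI b : b != 0 -> injective ( *%R b%:F).
  by move=> b0; apply: mulfI; rewrite tofrac_eq0.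
have com s y : E (s%:F * y) - s%:F * E y = E_ s y.
  have [a [b [b0 yE]]] := fracP y.
  have {}yE : b%:F * y = a%:F by rewrite yE mulrCA divff ?mulr1 ?tofrac_eq0.
  apply: (bI b b0); rewrite mulrBr (EE (s * a) b) //; last first.
    by rewrite mulrCA yE tofracM.
  rewrite mulrCA (EE a b) //.
  have := Esym b s y; rewrite yE EP => H.
  by apply: (subeq _ _ _ _ (esym H)); ring.
have Eadd : zmod_morphism E.
  move=> y z.
  have [a [b [b0 yE]]] := fracP y; have [c [e [e0 zE]]] := fracP z.
  have be0 : b * e != 0 by rewrite mulf_neq0.
  have {}yE : (b * e)%:F * y = (a * e)%:F.
    by rewrite yE !tofracM mulrAC mulrCA divff ?mulr1 // ?tofrac_eq0 // mulrC.
  have {}zE : (b * e)%:F * z = (b * c)%:F.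
    by rewrite zE !tofracM -mulrA; congr (_ * _);
       rewrite mulrCA divff ?mulr1 ?tofrac_eq0.
  apply: (bI _ be0); rewrite mulrBr (EE _ _ _ be0 yE) (EE _ _ _ be0 zE).
  rewrite (EE (a * e - b * c)) //; last by rewrite mulrBr yE zE tofracB.
  by rewrite PB tofracB EB; ring.
exists E; split=> // [s|x]; last first.
  have := EE x 1 x%:F (oner_neq0 _); rewrite tofrac1 !mul1r => -> //.
  by rewrite EP tofrac1 !mul1r subrr subr0.
have [r [t [t0 sE]]] := fracP s.
have tF0 : t%:F != 0 by rewrite tofrac_eq0.
have rE : r%:F = t%:F * s by rewrite sE mulrCA divff ?mulr1.
have H : order_lt d (fun y => t%:F^-1 * (E_ r y - E_ t (s * y))).
  by apply/order_lt_mul/order_ltB/order_lt_comp_mul.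
apply: eq_order_lt H => y /=; apply: (mulfI tF0).
by rewrite mulrA divff // mul1r -!com rE -!mulrA; ring.
Qed.

End FractionExtension.

Section FractionModule.
Variables (K : fieldType) (n : nat).
Local Notation S := (mpseries K n).
Local Notation D := (diffop (S : comAlgType K)).
Local Notation F := {fraction S}.
Local Notation "x %:F" := (@tofrac S x).
Implicit Types (P Q : D) (y z : F).

Fact diffop_fracext (P : D) : exists E : F -> F, is_fracext P E.
Proof.
have [_ [d HP]] := diffopP P.
have [E [EB Ed EP]] := fracext_exists (@diffopB _ _ P) HP.
by exists E; split=> //; exists d.
Qed.

(* D(S, K) acts on Frac(S) through the unique extension of each differential
   operator of S to a differential operator of Frac(S) (in characteristic 0,
   the quotient rule). *)
Definition frac_action (P : D) : F -> F := sval (cid (diffop_fracext P)).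

Lemma frac_actionP P : is_fracext P (frac_action P).
Proof. by rewrite /frac_action; case: cid. Qed.

Lemma frac_action_frac P (x : S) : frac_action P x%:F = (P x)%:F.
Proof. by case: (frac_actionP P). Qed.

Lemma frac_actionB P : zmod_morphism (frac_action P).
Proof. by case: (frac_actionP P). Qed.

Lemma frac_action_uniq (P : D) E : is_fracext P E -> E = frac_action P.
Proof. by move=> H; apply: is_fracext_uniq H (frac_actionP P). Qed.

Fact frac_actionA P Q y : frac_action P (frac_action Q y) = frac_action (P * Q) y.
Proof.
rewrite -(@frac_action_uniq (P * Q) (frac_action P \o frac_action Q)) //.
have [EB [d Ed] EP] := frac_actionP P; have [GB [e Ge] GQ] := frac_actionP Q.
split=> [x z|| x]; first by rewrite /= GB EB.
  by exists (d + e)%N; apply: order_lt_comp.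
by rewrite /= GQ EP.
Qed.

Fact frac_action1 : left_id 1 frac_action.
Proof.
move=> y; rewrite -(@frac_action_uniq 1 id) //; split=> //.
by exists 1%N => a x; rewrite subrr.
Qed.

Fact frac_actionDr : right_distributive frac_action +%R.
Proof.
move=> P y z; have B := frac_actionB P.
have N x : frac_action P (- x) = - frac_action P x.
  by rewrite -sub0r B -(subrr 0) B subrr sub0r.
by rewrite -[in LHS](opprK z) B N opprK.
Qed.

Fact frac_actionDl y : {morph frac_action^~ y : P Q / P + Q}.
Proof.
move=> P Q.
have BP := frac_actionB P; have BQ := frac_actionB Q.
have [_ [d Ed] EP] := frac_actionP P; have [_ [e Ge] GQ] := frac_actionP Q.
pose E z := frac_action P z - (0 - frac_action Q z).
rewrite -(@frac_action_uniq (P + Q) E); first by rewrite /E sub0r opprK.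
split.
- by move=> u v; rewrite /E BP BQ; ring.
- exists (maxn d e); apply: order_ltB; first exact: order_ltW (leq_maxl _ _) Ed.
  apply: order_ltB; first exact: order_lt_0.
  exact: order_ltW (leq_maxr _ _) Ge.
- move=> x; rewrite /E EP GQ sub0r opprK -tofracD; congr (_%:F).
  by rewrite -[RHS]/(diffop_add P Q x) diffop_addE.
Qed.

HB.instance Definition _ := GRing.Zmodule_isLmodule.Build D F
  frac_actionA frac_action1 frac_actionDr frac_actionDl.

End FractionModule.

(* Quotient of a module by a submodule, on top of the additive quotient of
   the library. *)
Section QuotientModule.
Variables (D : nzRingType) (M : lmodType D) (N : submodClosed M).

Definition quotmod_pred : {pred M} := fun x => x \in N.
HB.instance Definition _ := GRing.isZmodClosed.Build M quotmod_pred
  (GRing.submod_closedB (submodClosedP N)).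

Definition quotmod : Type := Quotient.quot quotmod_pred.
HB.instance Definition _ := GRing.Zmodule.on quotmod.
HB.instance Definition _ := EqQuotient.on quotmod.

Definition quotmod_scale (a : D) (x : quotmod) : quotmod :=
  (\pi_quotmod (a *: repr x)%R)%qT.

Lemma quotmod_eq (x y : M) :
  (\pi_quotmod x = \pi_quotmod y)%qT <-> x - y \in N.
Proof. by split=> [/eqP|H]; [|apply/eqP]; rewrite -Quotient.idealrBE. Qed.

Lemma quotmod_scale_pi a (x : M) :
  quotmod_scale a (\pi_quotmod x)%qT = (\pi_quotmod (a *: x))%qT.
Proof.
apply/quotmod_eq; rewrite -scalerBr; apply: rpredZ; apply/quotmod_eq.
exact: reprK.
Qed.

Lemma quotmod_piD (x y : M) :
  (\pi_quotmod (x + y) = \pi_quotmod x + \pi_quotmod y :> quotmod)%qT.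
Proof. exact: raddfD. Qed.

Fact quotmod_scaleA a b x :
  quotmod_scale a (quotmod_scale b x) = quotmod_scale (a * b) x.
Proof.
elim/quotW: x => x.
by rewrite (quotmod_scale_pi b x) (quotmod_scale_pi _ x) quotmod_scale_pi scalerA.
Qed.
Fact quotmod_scale1 : left_id 1 quotmod_scale.
Proof. by elim/quotW => x; rewrite quotmod_scale_pi scale1r. Qed.
Fact quotmod_scaleDr : right_distributive quotmod_scale +%R.
Proof.
move=> a x y; elim/quotW: x => x; elim/quotW: y => y.
by rewrite -quotmod_piD !quotmod_scale_pi scalerDr quotmod_piD.
Qed.
Fact quotmod_scaleDl x : {morph quotmod_scale^~ x : a b / a + b}.
Proof.
move=> a b; elim/quotW: x => x; rewrite !quotmod_scale_pi.
by rewrite -quotmod_piD scalerDl.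
Qed.

HB.instance Definition _ := GRing.Zmodule_isLmodule.Build D quotmod
  quotmod_scaleA quotmod_scale1 quotmod_scaleDr quotmod_scaleDl.

End QuotientModule.

(* There is a strictly increasing chain N_0 < N_1 < ... < N_k of submodules
   of M. *)
Definition has_chain (D : nzRingType) (M : lmodType D) (k : nat) : Prop :=
  exists N : nat -> {pred M},
    (forall i, (i <= k)%N -> submod_closed (N i)) /\
    (forall i, (i < k)%N ->
      {subset N i <= N i.+1} /\ exists2 x, x \in N i.+1 & x \notin N i).

Lemma has_chain0 (D : nzRingType) (M : lmodType D) :
  exists k, `[< has_chain M k >].
Proof.
exists 0%N; apply/asboolP; exists (fun=> xpredT); by split.
Qed.

(* The length of a module: the supremum, possibly +oo, of the lengths of the
   chains of submodules. *)
Definition module_length (D : nzRingType) (M : lmodType D) : \bar int :=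
  if pselect (exists b, forall k, `[< has_chain M k >] -> (k <= b)%N)
    is left bounded then (ex_maxn (has_chain0 M) (svalP (cid bounded)))%:Z%:E
  else +oo%E.

(* Local cohomology H^j_I(S), S = K[[x_1, ..., x_n]], with support in the ideal
   I = (g_0, ..., g_{s-1}), as the cohomology of the Cech complex
     C^j = \bigoplus_(|J| = j) S_{g_J},   g_J = \prod_(i in J) g_i.
   As S is a domain, every localization S_g is realized inside Frac(S), and
   the Cech complex is a complex of D(S, K)-submodules of Frac(S)^{2^s}. *)
Section LocalCohomology.
Variables (K : fieldType) (n s : nat).
Local Notation S := (mpseries K n).
Local Notation D := (diffop (S : comAlgType K)).
Local Notation F := {fraction S}.
Local Notation "x %:F" := (@tofrac S x).
Variable g : s.-tuple S.

(* S_h inside Frac(S); as 0^-1 = 0 in {fraction S}, the exponent k.+1 makes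
   this {0} when h = 0, as it should be. *)
Definition localization (h : S) : {pred F} :=
  fun y => `[< exists (a : S) (k : nat), y = a%:F / h%:F ^+ k.+1 >].

Definition cech_cochain (j : nat) : {pred {ffun {set 'I_s} -> F}} :=
  fun c => [forall J : {set 'I_s},
    if #|J| == j then c J \in localization (\prod_(i in J) tnth g i)
    else c J == 0].

(* The test discards the components with g_J = 0: there S_{g_J} = 0, and the
   localization map to it is not an inclusion inside Frac(S). *)
Definition cech_d (c : {ffun {set 'I_s} -> F}) : {ffun {set 'I_s} -> F} :=
  [ffun J : {set 'I_s} => if \prod_(i in J) tnth g i == 0 then 0 else
    \sum_(i in J) (-1) ^+ #|[set k in J | (k < i)%N]| * c (J :\ i)].

Definition cech_cocycle (j : nat) : {pred {ffun {set 'I_s} -> F}} :=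
  fun c => (c \in cech_cochain j) && (cech_d c == 0).

Definition cech_coboundary (j : nat) : {pred {ffun {set 'I_s} -> F}} :=
  fun c => if j is i.+1 then `[< exists2 b, b \in cech_cochain i & c = cech_d b >]
           else c == 0.

Lemma localizationP (h : S) (y : F) :
  reflect (exists (a : S) (k : nat), y = a%:F / h%:F ^+ k.+1)
          (y \in localization h).
Proof. exact: asboolP. Qed.

Lemma localization0 (h : S) : 0 \in localization h.
Proof. by apply/localizationP; exists 0, 0%N; rewrite tofrac0 mul0r. Qed.

Lemma localization_of0 y : y \in localization 0 -> y = 0.
Proof.
by move=> /localizationP[a [k ->]]; rewrite tofrac0 expr0n invr0 mulr0.
Qed.

Lemma localizationB (h : S) (y z : F) :
  y \in localization h -> z \in localization h -> y - z \in localization h.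
Proof.
have [->|h0] := eqVneq h 0.
  move=> /localization_of0 -> /localization_of0 ->.
  by rewrite subrr localization0.
have hF0 : h%:F != 0 by rewrite tofrac_eq0.
move=> /localizationP[a [k ->]] /localizationP[b [l ->]].
apply/localizationP; exists (a * h ^+ l.+1 - b * h ^+ k.+1), (k + l.+1)%N.
rewrite tofracB !tofracM !tofracXn -addSn exprD.
have hk : h%:F ^+ k.+1 != 0 by exact: expf_neq0.
have hl : h%:F ^+ l.+1 != 0 by exact: expf_neq0.
move: (h%:F ^+ k.+1) (h%:F ^+ l.+1) hk hl => u v u0 v0.
by rewrite [RHS]mulrBl invfM mulrACA divff // mulr1 mulrA mulfK.
Qed.

Lemma localization_div (h : S) (y : F) m :
  y \in localization h -> y / h%:F ^+ m \in localization h.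
Proof.
move=> /localizationP[a [k ->]]; apply/localizationP; exists a, (k + m)%N.
by rewrite -mulrA -invfM -exprD addSn.
Qed.

Lemma localization_frac (h a : S) : h != 0 -> a%:F \in localization h.
Proof.
move=> h0; apply/localizationP; exists (a * h), 0%N.
by rewrite tofracM expr1 mulfK // tofrac_eq0.
Qed.

Lemma localization_order d (E : F -> F) (h : S) (y : F) : h != 0 ->
    order_lt d E -> (forall x : S, exists z : S, E x%:F = z%:F) ->
  y \in localization h -> E y \in localization h.
Proof.
move=> h0; elim: d E => [|d IH] E HE ES.
  by rewrite (HE y) => _; apply: localization0.
move=> yh; have /localizationP[a [k yE]] := yh; set b := h ^+ k.+1.
have bF0 : b%:F != 0 by rewrite tofrac_eq0 expf_neq0.
have byE : b%:F * y = a%:F by rewrite yE -tofracXn mulrCA divff ?mulr1.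
have -> : E y = (E (b%:F * y) - (E (b%:F * y) - b%:F * E y)) / h%:F ^+ k.+1.
  by rewrite subKr -tofracXn mulrC mulKf.
apply/localization_div/localizationB.
  by rewrite byE; have [z ->] := ES a; apply: localization_frac.
apply: (IH _ (HE b%:F)) yh => x; rewrite -tofracM.
have [z ->] := ES (b * x); have [w ->] := ES x.
by exists (z - b * w); rewrite tofracB tofracM.
Qed.

Lemma localizationZ (P : D) (h : S) (y : F) :
  y \in localization h -> P *: y \in localization h.
Proof.
have [->|h0] := eqVneq h 0; first by move=> /localization_of0 ->; rewrite scaler0 localization0.
have [_ [d Ed] EP] := frac_actionP P.
by apply: (localization_order h0 Ed) => x; exists (P x); apply: EP.
Qed.

Local Notation M := {ffun {set 'I_s} -> F}.

Lemma frac_scaleN1 (P : D) m (y : F) :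
  P *: ((-1) ^+ m * y) = (-1) ^+ m * (P *: y).
Proof.
by rewrite -signr_odd !mulr_sign; case: (odd m); rewrite ?scalerN.
Qed.

Fact cech_d_linear : linear (cech_d : M -> M).
Proof.
move=> P b c; apply/ffunP => J; rewrite !ffunE.
case: ifP => _; first by rewrite scaler0 addr0.
rewrite scaler_sumr -big_split /=.
apply: eq_bigr => i _; rewrite !ffunE mulrDr frac_scaleN1 //.
Qed.

HB.instance Definition _ := GRing.isLinear.Build D M M *:%R cech_d cech_d_linear.

Fact cech_cochain_submod j : submod_closed (cech_cochain j).
Proof.
split=> [|P b c /forallP Hb /forallP Hc]; apply/forallP => J.
  by rewrite !ffunE localization0 eqxx if_same.
have := Hc J; have := Hb J; rewrite !ffunE; case: ifP => _.
  move=> bJ cJ; rewrite -[c J]opprK; apply: localizationB.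
    exact: localizationZ.
  by rewrite -[- _]sub0r localizationB ?localization0.
by move=> /eqP -> /eqP ->; rewrite scaler0 addr0.
Qed.

Fact cech_cocycle_submod j : submod_closed (cech_cocycle j).
Proof.
have [C0 CD] := cech_cochain_submod j; split=> [|P b c].
  by apply/andP; rewrite linear0 eqxx.
move=> /andP[bC /eqP db] /andP[cC /eqP dc]; apply/andP.
by rewrite CD // cech_d_linear db dc scaler0 addr0 eqxx.
Qed.

HB.instance Definition _ j := GRing.isSubmodClosed.Build D M (cech_cocycle j)
  (cech_cocycle_submod j).

Fact cech_coboundary_submod j : submod_closed (cech_coboundary j).
Proof.
case: j => [|j].
  by split=> [|P b c /eqP -> /eqP ->]; apply/eqP; rewrite ?scaler0 ?addr0.
have [C0 CD] := cech_cochain_submod j; split=> [|P b c].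
  by apply/asboolP; exists 0; rewrite ?linear0.
move=> /asboolP[b' bC ->] /asboolP[c' cC ->]; apply/asboolP.
by exists (P *: b' + c'); [exact: CD|rewrite cech_d_linear].
Qed.

Record cocycle (j : nat) := Cocycle {
  cocycle_val :> M;
  _ : cocycle_val \in cech_cocycle j }.
HB.instance Definition _ j := [isSub for @cocycle_val j].
HB.instance Definition _ j := [Choice of cocycle j by <:].
HB.instance Definition _ j := [SubChoice_isSubLmodule of cocycle j by <:].

(* Since d \o d = 0, intersecting with the cocycles loses no coboundary. *)
Definition coboundary (j : nat) : {pred cocycle j} :=
  fun c => cocycle_val c \in cech_coboundary j.

Fact coboundary_submod j : submod_closed (@coboundary j).
Proof.
have [B0 BD] := cech_coboundary_submod j; split=> [|P b c bB cB].
  exact: B0.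
exact: BD.
Qed.

HB.instance Definition _ j := GRing.isSubmodClosed.Build D (cocycle j)
  (@coboundary j) (coboundary_submod j).

Definition local_cohomology (j : nat) : lmodType D := quotmod (@coboundary j).

End LocalCohomology.

(* The generalized Lyubeznik number \lambda^i_0(A) of A = T/(g_0, ..., g_{s-1}),
   T = K[[y_1, ..., y_r]], read off the canonical surjection T -> A (A is
   complete): the length of H^{r-i}_{(g)}(T) as a D(T, K)-module. It is 0 for
   i > r, where r - i is negative. *)
Definition lyubeznik0 (K : fieldType) (r s : nat)
    (g : s.-tuple (mpseries K r)) (i : nat) : \bar int :=
  if (i <= r)%N then module_length (local_cohomology g (r - i)) else 0%E.

Definition irreducible_elt (R : idomainType) (p : R) : Prop :=
  [/\ p != 0, p \isn't a GRing.unit &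
    forall a b, p = a * b -> (a \is a GRing.unit) || (b \is a GRing.unit)].

Definition associated (R : idomainType) (p q : R) : Prop :=
  exists2 u, u \is a GRing.unit & q = u * p.

(* Main.v *)
(** Since [S] is a domain, [H^1_g(S)] is [S_g / S], so its length is the
    supremum of the lengths of the chains of D-submodules of Frac(S) between
    [S] and [S_g]. If [g] and [h] are coprime nonunits, then [S_g] and [S_h]
    meet in [S], while [1 / (g h)] is not in [S_g + S_h] because [S] is local;
    hence a chain [N_i] for [g] and a chain [L_i] for [h] combine into the
    chain formed by the [N_i], the [S_g + L_i] and [S_gh], which has one step
    more than the two together. Gluing the [l] factors one after the other
    gives the [l - 1] extra steps.

    Coprimality of nonassociated irreducibles amounts to [K[[x_1, ..., x_n]]]
    being factorial, proved by induction on [n]: after a substitution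
    [x_i |-> x_i + t ^ e_i], with [t] the last variable, an irreducible series
    is regular in [t], hence associated to a monic polynomial [P] in [t] by
    Weierstrass preparation. Gauss' lemma, which needs the primes of the ring
    in [n - 1] variables, makes [P] prime among polynomials, and Weierstrass
    division carries this over to the series. *)
Require Import Defs.
From mathcomp Require Import all_boot all_order all_algebra.
From mathcomp Require Import fraction ring_quotient mpoly.
From mathcomp Require Import boolp constructive_ereal.
From mathcomp Require Import ring zify.

Set Implicit Arguments.
Unset Strict Implicit.
Unset Printing Implicit Defensive.

Import Order.TTheory GRing.Theory Num.Theory.

Local Open Scope ring_scope.

(** * Power series *)

Section SeriesBasics.
Variables (K : fieldType) (n : nat).
Local Notation S := (mpseries K n).
Implicit Types (f g : S) (m : 'X_{1..n}).

Lemma mpsD f g m : (f + g) m = f m + g m. Proof. by []. Qed.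
Lemma mpsN f m : (- f) m = - f m. Proof. by []. Qed.
Lemma mpsB f g m : (f - g) m = f m - g m. Proof. by []. Qed.
Lemma mpsZ (c : K) f m : (c *: f : S) m = c * f m. Proof. by []. Qed.
Lemma mps1 m : (1 : S) m = (m == 0%MM)%:R. Proof. by []. Qed.

Lemma mps_sum I (r : seq I) (P : pred I) (F : I -> S) m :
  (\sum_(i <- r | P i) F i) m = \sum_(i <- r | P i) F i m.
Proof. by apply: (big_morph (fun f : S => f m)). Qed.

Lemma mpsM f g m : (f * g) m =
  \sum_(k : 'X_{1..n < (mdeg m).+1, (mdeg m).+1} | m == (k.1 + k.2)%MM)
    f k.1 * g k.2.
Proof. by []. Qed.

Lemma mpsM_trunc d f g m : (mdeg m < d)%N ->
  (f * g) m = (mps_trunc d f * mps_trunc d g)@_m.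
Proof. by move=> md; rewrite (@mps_mul_trunc _ _ d f g) // => k; exact: mps_truncE. Qed.

Lemma mps0M f g : (f * g) 0%MM = f 0%MM * g 0%MM.
Proof.
rewrite (@mpsM_trunc 1) ?mdeg0 // mcoeffM.
have d0 : (mdeg (0%MM : 'X_{1..n}) < (mdeg (0%MM : 'X_{1..n})).+1)%N by [].
rewrite (bigD1 (BMultinom d0, BMultinom d0)) /= ?addm0 //.
rewrite !mps_truncE ?mdeg0 // big1 ?addr0 // => -[[k1 k1d] [k2 k2d]] /= /andP[_].
have z k : (mdeg k < (mdeg (0%MM : 'X_{1..n})).+1)%N -> k = 0%MM.
  by rewrite mdeg0 ltnS leqn0 mdeg_eq0 => /eqP.
move=> /negP[].
by apply/eqP; congr pair; apply/val_inj/z.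
Qed.

(** The weight is a parameter because two gradings occur: the total degree [mdeg], for units and
    orders, and the degree in all variables but the last, for Weierstrass division. *)
Definition vanishes (w : 'X_{1..n} -> nat) (d : nat) f :=
  forall m, (w m < d)%N -> f m = 0.

Lemma vanishesM a b (w : 'X_{1..n} -> nat) f g :
  (forall m k, w (m + k)%MM = (w m + w k)%N) ->
  vanishes w a f -> vanishes w b g -> vanishes w (a + b) (f * g).
Proof.
move=> wD fa gb m md; rewrite mpsM big1 // => -[[k1 k1d] [k2 k2d]] /= /eqP mE.
have lt : (w k1 + w k2 < a + b)%N by rewrite -wD -mE.
have [/fa ->|ge1] := ltnP (w k1) a; first by rewrite mul0r.
by rewrite gb ?mulr0 //; lia.
Qed.

(* The Neumann series [\sum_k (- T)^k g] solves the equation; only its first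
   [w m] terms contribute to the coefficient of [m]. *)
Lemma contraction_surj (w : 'X_{1..n} -> nat) (T : S -> S) :
    zmod_morphism T ->
    (forall d f, vanishes w d f -> vanishes w d.+1 (T f)) ->
  forall g, exists z, z + T z = g.
Proof.
move=> TB TW g.
have T0 : T 0 = 0 by have := TB 0 0; rewrite !subrr.
have TN f : T (- f) = - T f by rewrite -sub0r TB T0 sub0r.
have TD f h : T (f + h) = T f + T h by rewrite -[h in LHS]opprK TB TN opprK.
pose it k := iter k (fun f => - T f) g.
have itW k : vanishes w k (it k).
  elim: k => [|k IH] m //; rewrite /it iterS -/(it k) => mk.
  by rewrite mpsN (TW k) ?oppr0.
pose z : S := fun m => \sum_(k < (w m).+1) it k m.
pose s N := \sum_(k < N) it k.
have sW N : vanishes w N (z - s N).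
  move=> m mN; rewrite mpsB /s mps_sum /z.
  apply/eqP; rewrite subr_eq0; apply/eqP.
  rewrite -!(big_mkord xpredT (fun k => it k m)) [RHS](big_cat_nat (n := (w m).+1)) //=.
  rewrite [X in _ + X]big_nat_cond [X in _ + X]big1 ?addr0 //.
  by move=> k /andP[/andP[km _] _]; rewrite itW.
have sS N : s N.+1 = s N + it N by rewrite /s big_ord_recr.
have sT N : s N.+1 + T (s N) = g.
  elim: N => [|N IH]; first by rewrite sS /s big_ord0 T0 addr0 add0r.
  by rewrite sS [in T _]sS TD [it N.+1]iterS -/(it N) -[in RHS]IH; ring.
exists z; apply/funext => m.
pose N := (w m).+1.
have zTE : T z = T (s N) + T (z - s N) by rewrite -TD addrC subrK.
have -> : z + T z = g + ((z - s N.+1) + T (z - s N)).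
  by rewrite zTE -[in RHS](sT N); ring.
have mN : (w m < N.+1)%N by rewrite /N ltnS ltnW.
by rewrite mpsD [X in _ + X]mpsD (sW _ _ mN) (TW _ _ (sW N) _ mN) !addr0.
Qed.

(** The equation z = - T z raises the order of z without end. *)
Lemma contraction_inj (w : 'X_{1..n} -> nat) (T : S -> S) :
    (forall d f, vanishes w d f -> vanishes w d.+1 (T f)) ->
  forall z, z + T z = 0 -> z = 0.
Proof.
move=> TW z zT; apply/funext => m.
have {}zT : z = - T z by apply/eqP; rewrite -addr_eq0 zT.
suff H d : vanishes w d z by apply: (H (w m).+1).
elim: d => [|d IH] k // kd; rewrite zT mpsN.
by rewrite (TW d) // oppr0.
Qed.

(** After rescaling to constant term 1, [f] is 1 + v with v of positive order, and 1 + v is inverted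
    by solving z + v z = 1. *)
Lemma mps_unitE f : (f \is a GRing.unit) = (f 0%MM != 0).
Proof.
apply/idP/idP => [fU|f0].
  have := congr1 (fun g : S => g 0%MM) (mulVr fU); rewrite /= mps0M mps1 eqxx.
  by move=> H; apply/eqP => f0; move/eqP: H; rewrite f0 mulr0 eq_sym oner_eq0.
pose c := f 0%MM; pose v := c^-1 *: f - 1.
have v0 : vanishes mdeg 1 v.
  move=> m; rewrite ltnS leqn0 mdeg_eq0 => /eqP ->.
  by rewrite /v mpsB mps1 eqxx mpsZ mulVf // subrr.
have [||z Hz] := @contraction_surj mdeg (fun z => v * z) _ _ 1.
- by move=> x y; rewrite mulrBr.
- move=> d g gd; rewrite -add1n; apply: vanishesM => // m k; exact: mdegD.
apply/unitrP; exists (c^-1 *: z); split; rewrite -?scalerAl -?scalerAr.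
  by rewrite -Hz /v mulrBl mul1r addrC subrK -scalerAl mulrC.
by rewrite -Hz /v mulrBl mul1r addrC subrK -scalerAl.
Qed.

(** Locality of the ring: the nonunits are the series without constant term, and these form an
    ideal. *)
Lemma mps_nonunit_comb (a b f g : S) : f \isn't a GRing.unit ->
  g \isn't a GRing.unit -> a * f + b * g != 1.
Proof.
rewrite !mps_unitE !negbK => /eqP f0 /eqP g0.
apply/eqP => /(congr1 (fun h : S => h 0%MM)) /=.
by rewrite mpsD !mps0M f0 g0 !mulr0 addr0 mps1 eqxx => /esym/eqP; rewrite oner_eq0.
Qed.

Lemma mps_neq0_vanishes f : f != 0 -> exists d, ~ vanishes mdeg d f.
Proof.
move=> f0; apply: contrapT => H; case/eqP: f0; apply/funext => m.
apply: contrapT => fm; apply: H; exists (mdeg m).+1 => H.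
by apply: fm; apply: H.
Qed.

Lemma vanishes_nonunit f : f \isn't a GRing.unit -> vanishes mdeg 1 f.
Proof.
rewrite mps_unitE negbK => /eqP f0 m; rewrite ltnS leqn0 mdeg_eq0 => /eqP ->.
exact: f0.
Qed.

(** Induction on a bound for the order: splitting off a nonunit lowers the order of the other
    factor. *)
Lemma irreducible_factor f : f != 0 -> f \isn't a GRing.unit ->
  exists p g, irreducible_elt p /\ f = p * g.
Proof.
move=> f0 fU; have [d] := mps_neq0_vanishes f0.
elim: d f f0 fU => [f _ _ []|d IH] // f f0 fU fd.
have [[[a b] /= [fE aU bU]]|H] := pselect (exists ab : S * S,
  [/\ f = ab.1 * ab.2, ab.1 \isn't a GRing.unit & ab.2 \isn't a GRing.unit]).
  have a0 : a != 0 by move: f0; rewrite fE mulf_eq0; case: eqP.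
  have [|p [g [pI ag]]] := IH a a0 aU.
    move=> ad; apply: fd; rewrite fE -addn1; apply: vanishesM (vanishes_nonunit bU) => //.
    exact: mdegD.
  by exists p, (g * b); split=> //; rewrite mulrA -ag.
exists f, 1; rewrite mulr1; split=> //; split=> // a b fE.
by apply/contraT; rewrite negb_or => /andP[aU bU]; case: H; exists (a, b).
Qed.

End SeriesBasics.

(** * Weierstrass preparation *)

Section Slices.
Variables (K : fieldType) (n : nat).
Local Notation R := (mpseries K n).
Local Notation S := (mpseries K n.+1).
Implicit Types (f g p q : S) (m : 'X_{1..n}) (a b : nat -> R) (P Q : {poly R}).

Definition mnmext m j : 'X_{1..n.+1} := [multinom of rcons m j].
Definition mnminit (k : 'X_{1..n.+1}) : 'X_{1..n} :=
  [multinom k (widen_ord (leqnSn n) i) | i < n].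

Lemma mnmext_max m j : mnmext m j ord_max = j.
Proof. by rewrite multinomE (tnth_nth 0%N) nth_rcons /= size_tuple ltnn eqxx. Qed.

Lemma mnmext_widen m j i : mnmext m j (widen_ord (leqnSn n) i) = m i.
Proof.
rewrite multinomE (tnth_nth 0%N) nth_rcons /=.
by rewrite size_tuple ltn_ord (mnm_nth 0%N).
Qed.

Lemma mnmextK m j : mnminit (mnmext m j) = m.
Proof. by apply/mnmP => i; rewrite mnmE mnmext_widen. Qed.

Lemma mnmext_init k : mnmext (mnminit k) (k ord_max) = k.
Proof.
apply/mnmP => i; have [lt|ge] := ltnP i n.
  have -> : i = widen_ord (leqnSn n) (Ordinal lt) by apply/val_inj.
  by rewrite mnmext_widen mnmE.
have -> : i = ord_max by apply/val_inj/eqP; rewrite /= eqn_leq ge -ltnS ltn_ord.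
by rewrite mnmext_max.
Qed.

Lemma mdeg_mnmext m j : mdeg (mnmext m j) = (mdeg m + j)%N.
Proof.
rewrite !mdegE big_ord_recr /= mnmext_max; congr (_ + _)%N.
by apply: eq_bigr => i _; rewrite mnmext_widen.
Qed.

Lemma coef_muni (p : {mpoly K[n.+1]}) m j : (muni p)`_j@_m = p@_(mnmext m j).
Proof.
rewrite muniE [in RHS](mpolyE p) coef_sum !raddf_sum /=; apply: eq_bigr => k _.
rewrite coefZ coefXn mulr_natr raddfMn /= !mcoeffZ !mcoeffX -mulrnAr; congr (_ * _).
have -> : [multinom k (widen_ord (leqnSn n) i) | i < n] = mnminit k by [].
have [->|ne] := eqVneq k (mnmext m j).
  by rewrite mnmextK mnmext_max !eqxx.
case: eqVneq => [mE|_]; case: eqVneq => [jE|_] ; rewrite ?mulr0n ?mul0rn //.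
by case/eqP: ne; rewrite -mE jE mnmext_init.
Qed.

(** The coefficient of t^j, where t is the last variable and [f] is read as a series in t over [R].
    Conversely, [glue] builds a series from its coefficients in t. *)
Definition slice j f : R := fun m => f (mnmext m j).
Definition glue a : S := fun k => a (k ord_max) (mnminit k).

Lemma slice_glue a j : slice j (glue a) = a j.
Proof. by apply/funext => m; rewrite /slice /glue mnmext_max mnmextK. Qed.

Lemma slice_inj f g : (forall j, slice j f = slice j g) -> f = g.
Proof.
move=> fg; apply/funext => k; rewrite -(mnmext_init k).
exact: (congr1 (fun h : R => h _) (fg _)).
Qed.

Lemma sliceB j : {morph slice j : f g / f - g}. Proof. by []. Qed.
Lemma sliceD j : {morph slice j : f g / f + g}. Proof. by []. Qed.

(** A coefficient of a product only depends on truncations, and for polynomials this formula is the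
    multiplicativity of [muni]. *)
Lemma sliceM j f g :
  slice j (f * g) = \sum_(i < j.+1) slice i f * slice (j - i) g.
Proof.
apply/funext => m; rewrite mps_sum /slice; set d := (mdeg m + j).+1.
have dm : (mdeg (mnmext m j) < d)%N by rewrite mdeg_mnmext.
rewrite (mpsM_trunc _ _ dm) -coef_muni rmorphM coefM raddf_sum /=.
apply: eq_bigr => i _.
have ij : (i <= j)%N by rewrite -ltnS.
rewrite (@mps_mul_trunc _ _ (mdeg m).+1 (slice i f) (slice (j - i) g)) // => k km;
  by rewrite coef_muni mps_truncE // mdeg_mnmext /d; lia.
Qed.

End Slices.

Section Weierstrass.
Variables (K : fieldType) (n : nat).
Local Notation R := (mpseries K n).
Local Notation S := (mpseries K n.+1).
Implicit Types (f g p q : S) (m : 'X_{1..n}) (P Q : {poly R}).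

Definition series_of_poly P : S := glue (fun i => P`_i).
Local Notation ser := series_of_poly.

Lemma slice_series_of_poly P i : slice i (ser P) = P`_i.
Proof. exact: slice_glue. Qed.

Lemma series_of_polyB : {morph ser : P Q / P - Q}.
Proof. by move=> P Q; apply: slice_inj => i; rewrite sliceB !slice_series_of_poly coefB. Qed.

Lemma series_of_poly0 : ser 0 = 0.
Proof. by apply: slice_inj => i; rewrite slice_series_of_poly coef0. Qed.

Lemma series_of_polyM : {morph ser : P Q / P * Q}.
Proof.
move=> P Q; apply: slice_inj => i; rewrite sliceM slice_series_of_poly coefM.
by apply: eq_bigr => j _; rewrite !slice_series_of_poly.
Qed.

Lemma series_of_poly_inj : injective ser.
Proof. by move=> P Q PQ; apply/polyP => i; rewrite -!slice_series_of_poly PQ. Qed.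

(** [shift d] and [lower d] are the quotient and the remainder of the division by t^d. *)
Definition shift d f : S := glue (fun i => slice (i + d) f).
Definition lower d f : S := glue (fun i => if (i < d)%N then slice i f else 0).

Lemma slice_XnM d f j :
  slice j (ser 'X^d * f) = if (j < d)%N then 0 else slice (j - d) f.
Proof.
rewrite sliceM; case: ltnP => jd.
  rewrite big1 // => i _; rewrite slice_series_of_poly coefXn.
  have /negbTE -> : (i : nat) != d by have := ltn_ord i; lia.
  by rewrite mul0r.
rewrite (bigD1 (Ordinal (_ : d < j.+1)%N)) //= slice_series_of_poly coefXn eqxx mul1r.
rewrite big1 ?addr0 // => i /eqP ne; rewrite slice_series_of_poly coefXn.
have /negbTE -> : (i : nat) != d by apply/eqP => e; apply: ne; apply/val_inj.
by rewrite mul0r.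
Qed.

Lemma lower_shift d f : f = lower d f + ser 'X^d * shift d f.
Proof.
apply: slice_inj => i; rewrite sliceD slice_XnM !slice_glue.
by case: ltnP => id; rewrite ?addr0 // add0r subnK.
Qed.

Lemma shift_XnM d f : shift d (ser 'X^d * f) = f.
Proof.
apply: slice_inj => i; rewrite slice_glue slice_XnM.
by rewrite ltnNge leq_addl /= addnK.
Qed.

Lemma shiftB d : {morph shift d : f g / f - g}.
Proof. by move=> f g; apply: slice_inj => i; rewrite sliceB !slice_glue. Qed.

Lemma shiftD d : {morph shift d : f g / f + g}.
Proof. by move=> f g; apply: slice_inj => i; rewrite sliceD !slice_glue. Qed.

Lemma shift_series_of_poly d P : (size P <= d)%N -> shift d (ser P) = 0.
Proof.
move=> Pd; apply: slice_inj => i; rewrite slice_glue slice_series_of_poly nth_default //.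
by apply: leq_trans Pd (leq_addl _ _).
Qed.

Lemma series_of_poly_of_shift0 d f : shift d f = 0 ->
  exists2 P : {poly R}, (size P <= d)%N & f = ser P.
Proof.
move=> fd; exists (\poly_(i < d) slice i f); first exact: size_poly.
apply: slice_inj => i; rewrite slice_series_of_poly coef_poly; case: ltnP => // id.
by have := congr1 (slice (i - d)) fd; rewrite slice_glue subnK.
Qed.

(** The value [slice i p 0%MM] is the coefficient of t^i in p(0, ..., 0, t), so the condition says
    that this one-variable series has order exactly [d]. *)
Definition regular_order d p :=
  (forall i, (i < d)%N -> slice i p 0%MM = 0) /\ slice d p 0%MM != 0.

Variables (d : nat) (p : S).
Hypothesis p_reg : regular_order d p.

Let w (k : 'X_{1..n.+1}) := mdeg (mnminit k).
Let u := shift d p.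
(** Since [p] is [lower d p] plus t^d times the unit [u], the part of q p of degree at least [d] in
    t is t^d times z + T z, where z = q u. Division of [g] by [p] thus becomes the equation z + T z
    = [shift d g]. *)
Let T f := shift d (f / u * lower d p).

Let wD k l : w (k + l)%MM = (w k + w l)%N.
Proof.
rewrite /w -mdegD; congr mdeg; apply/mnmP => i.
by rewrite !(mnmE, mnmDE).
Qed.

Let u_unit : u \is a GRing.unit.
Proof.
rewrite mps_unitE; have := p_reg.2; congr (_ != 0).
rewrite /u -(mnmext_init 0%MM) -[RHS]/(slice _ _ _) slice_glue mnm0E add0n.
by congr (slice d p _); apply/mnmP => i; rewrite !(mnmE, mnm0E).
Qed.

Let TB : zmod_morphism T.
Proof. by move=> f g; rewrite /T -shiftB -mulrBl -mulrBl. Qed.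

(** By regularity the slices of [p] below [d] have no constant term, so multiplication by
    [lower d p] raises the weight [w]; [shift] only moves powers of t, which [w] ignores. *)
Let TW c f : vanishes w c f -> vanishes w c.+1 (T f).
Proof.
move=> fc.
have low1 : vanishes w 1 (lower d p).
  move=> k; rewrite ltnS leqn0 /w mdeg_eq0 => /eqP k0.
  rewrite /lower /glue k0; case: ltnP => // /p_reg.1 //.
have low : vanishes w c.+1 (f / u * lower d p).
  rewrite -[c.+1]addn1; apply: vanishesM => //; rewrite -[c]addn0.
  exact: vanishesM.
by move=> k kc; rewrite /T /shift /glue /slice low // /w mnmextK.
Qed.

Let shiftM q : shift d (q * p) = q * u + T (q * u).
Proof.
rewrite {1}(lower_shift d p) mulrDr mulrCA shiftD shift_XnM /T mulrK //.
by rewrite addrC.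
Qed.

Lemma weierstrass_division g :
  exists q (P : {poly R}), (size P <= d)%N /\ g = q * p + ser P.
Proof.
have [z zE] := contraction_surj TB TW (shift d g).
have zs : shift d (z / u * p) = shift d g by rewrite shiftM divrK.
have [|P Pd gE] := @series_of_poly_of_shift0 d (g - z / u * p).
  by rewrite shiftB zs subrr.
by exists (z / u), P; split=> //; rewrite -gE addrC subrK.
Qed.

(** Shifting a polynomial of degree below [d] gives 0, so z = q u solves z + T z = 0. *)
Lemma weierstrass_uniq q P : (size P <= d)%N -> q * p = ser P -> P = 0.
Proof.
move=> Pd qp; have := shiftM q; rewrite qp shift_series_of_poly // => /esym.
move=> /(contraction_inj TW) qu.
have q0 : q = 0 by rewrite -(mulrK u_unit q) qu mul0r.
by apply: series_of_poly_inj; rewrite -qp q0 mul0r series_of_poly0.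
Qed.

(** Divide t^d by [p]: the monic polynomial is t^d minus the remainder. *)
Lemma weierstrass_preparation :
  exists q (P : {poly R}), 
    [/\ q \is a GRing.unit, P \is monic, size P = d.+1 & ser P = q * p].
Proof.
have [q [Q [Qd XE]]] := weierstrass_division (ser 'X^d).
have QX : (size (- Q) < size ('X^d : {poly R}))%N by rewrite size_polyN size_polyXn.
exists q, ('X^d - Q); split.
(* Compare the constant terms of the coefficients of t^d. The remainder has lower degree, and the
   slices of [p] below [d] have no constant term, so 1 is the product of the constant terms of [q]
   and of [slice d p]. *)
- have := congr1 (fun h => slice d h 0%MM) XE; rewrite sliceD !slice_series_of_poly coefXn eqxx.
  rewrite [Q`_d]nth_default // addr0 sliceM mps_sum big_ord_recl /= subn0 mps0M.
  rewrite big1 ?addr0; last first.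
    move=> i _; rewrite mps0M p_reg.1 ?mulr0 //= /bump /=.
    by have := ltn_ord i; lia.
  rewrite mulr1n mps1 eqxx mps_unitE => /esym H.
  have -> : q 0%MM = slice 0 q 0%MM.
    rewrite -(mnmext_init 0%MM) mnm0E; congr (slice 0 q _).
    by apply/mnmP => i; rewrite !(mnmE, mnm0E).
  by apply/eqP => q0; move/eqP: H; rewrite q0 mul0r eq_sym oner_eq0.
- by rewrite monicE lead_coefDl // lead_coefXn.
- by rewrite size_polyDl // size_polyXn.
- by rewrite series_of_polyB XE addrK.
Qed.

End Weierstrass.

(** * Divisibility and Gauss' lemma *)

Definition divides (R : comNzRingType) (p a : R) := exists c, a = c * p.

(** Units satisfy this as well; being a nonunit is part of [irreducible_elt]. *)
Definition prime_elt (R : comNzRingType) (p : R) :=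
  forall a b, divides p (a * b) -> divides p a \/ divides p b.

Section Divides.
Variable R : comNzRingType.
Implicit Types a b p : R.

Lemma dividesD p a b : divides p a -> divides p b -> divides p (a + b).
Proof. by move=> [c ->] [e ->]; exists (c + e); rewrite mulrDl. Qed.

Lemma dividesB p a b : divides p a -> divides p b -> divides p (a - b).
Proof. by move=> [c ->] [e ->]; exists (c - e); rewrite mulrBl. Qed.

Lemma divides_mull p a b : divides p b -> divides p (a * b).
Proof. by move=> [c ->]; exists (a * c); rewrite mulrA. Qed.

Lemma divides_mulr p a b : divides p a -> divides p (a * b).
Proof. by move=> pa; rewrite mulrC; apply: divides_mull. Qed.

Lemma divides_sum p I (r : seq I) (P : pred I) (F : I -> R) :
  (forall i, P i -> divides p (F i)) -> divides p (\sum_(i <- r | P i) F i).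
Proof.
by move=> H; elim/big_ind: _ => //; [exists 0; rewrite mul0r|exact: dividesD].
Qed.

Lemma ndivides_min p (G : nat -> R) : ~ (forall i, divides p (G i)) ->
  exists2 i, ~ divides p (G i) & forall j, (j < i)%N -> divides p (G j).
Proof.
move=> H; have Hex : exists i, ~~ `[< divides p (G i) >].
  apply: contrapT => N; apply: H => i; apply: contrapT => Ni.
  by apply: N; exists i; apply/asboolPn.
case: (ex_minnP Hex) => i /asboolPn Ni min; exists i => // j ji.
by apply: contrapT => /asboolPn /min; rewrite leqNgt ji.
Qed.

(** If i and j are the least indices of coefficients of [G] and [H] that [p] does not divide, the
    coefficient of index i + j of the product is [G]_i * H[_j] plus multiples of [p]. *)
Lemma prime_elt_poly p (G H : {poly R}) : prime_elt p ->
  (forall i, divides p (G * H)`_i) ->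
  (forall i, divides p G`_i) \/ (forall i, divides p H`_i).
Proof.
move=> pP GH; apply: contrapT => /not_orP[].
move=> /ndivides_min[i Ni Gi] /ndivides_min[j Nj Hj].
have ilt : (i < (i + j).+1)%N by rewrite ltnS leq_addr.
have := GH (i + j)%N; rewrite coefM (bigD1 (Ordinal ilt)) //= addKn => Hs.
suff Hr : divides p (\sum_(k < (i + j).+1 | k != Ordinal ilt) G`_k * H`_(i + j - k)).
  by have := dividesB Hs Hr; rewrite addrK => /pP[].
apply: divides_sum => k kN; have [ki|ik] := ltnP k i.
  exact/divides_mulr/Gi.
apply/divides_mull/Hj.
have ne : (k : nat) != i by apply: contraNneq kN => e; apply/eqP/val_inj.
by have := ltn_ord k; lia.
Qed.

Lemma divides_coefP p (G : {poly R}) : (forall i, divides p G`_i) ->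
  exists G', G = p *: G'.
Proof.
move=> /choice[c cE]; exists (\poly_(i < size G) c i); apply/polyP => i.
rewrite coefZ coef_poly; case: ltnP => Gi; first by rewrite cE mulrC.
by rewrite nth_default // mulr0.
Qed.

End Divides.

Section GaussLemma.
Variables (K : fieldType) (n : nat).
Local Notation R := (mpseries K n).
Hypothesis irr_prime : forall p : R, irreducible_elt p -> prime_elt p.
Implicit Types P G H A B : {poly R}.

(** The irreducible factors of [c] are removed one at a time: each divides all the coefficients of
    [G] or all those of [H]. The induction is on a bound for the order of [c]. *)
Lemma gauss_lemma c P G H : c != 0 -> c *: P = G * H ->
  exists G' H', [/\ P = G' * H', size G' = size G & size H' = size H].
Proof.
move=> c0; have [d] := mps_neq0_vanishes c0.
elim: d c c0 G H => [c _ G H []|d IH] // c c0 G H cd cP.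
have [cU|cU] := boolP (c \is a GRing.unit).
  exists (c^-1 *: G), H; split=> //; last by rewrite size_scale // invr_eq0.
  by rewrite -scalerAl -cP scalerA mulVr // scale1r.
have [p [e [pI ce]]] := irreducible_factor c0 cU.
have [p0 pU _] := pI.
have e0 : e != 0 by move: c0; rewrite ce mulf_eq0 negb_or => /andP[].
have ed : ~ vanishes mdeg d e.
  move=> ed; apply: cd; rewrite ce -[d.+1]add1n.
  by apply: vanishesM (vanishes_nonunit pU) ed; exact: mdegD.
have pI' : injective ( *:%R p : {poly R} -> {poly R}).
  move=> A B /eqP; rewrite -subr_eq0 -scalerBr -mul_polyC mulf_eq0 polyC_eq0.
  by rewrite (negbTE p0) subr_eq0 => /eqP.
have [i||] := prime_elt_poly (irr_prime pI) (_ : forall i, divides p (G * H)`_i).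
- by rewrite -cP coefZ ce -mulrA mulrC; apply/divides_mull; exists 1; rewrite mul1r.
- move=> /divides_coefP[G1 GE].
  have [|G' [H' [PE sG sH]]] := IH e e0 G1 H ed.
    by apply: pI'; rewrite scalerA -ce cP GE scalerAl.
  by exists G', H'; split=> //; rewrite sG GE size_scale.
- move=> /divides_coefP[H1 HE].
  have [|G' [H' [PE sG sH]]] := IH e e0 G H1 ed.
    by apply: pI'; rewrite scalerA -ce cP HE scalerAr.
  by exists G', H'; split=> //; rewrite sH HE size_scale.
Qed.

(** The gcd [D] of [P] and [A] divides [P] up to a scalar, and Gauss' lemma turns this into a true
    factorization with the same degrees. Either the cofactor is constant, and [P] divides [A] like
    [D], or [D] is constant, and [P], coprime to [A], divides [B]. As [P] is monic, divisibility up
    to a scalar is divisibility. *)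
Lemma monic_irreducible_prime P : P \is monic ->
    (forall G H, P = G * H -> size G = 1%N \/ size H = 1%N) ->
  prime_elt P.
Proof.
move=> Pm Pirr A B.
have dvdE C : divides P C <-> Pdiv.IdomainDefs.dvdp P C.
  by split=> [[Q ->]|/Pdiv.IdomainMonic.dvdpP[|Q ->]] //;
    [apply/Pdiv.IdomainMonic.dvdpP => //; exists Q|exists Q].
rewrite !dvdE => PAB; set D := gcdp P A.
have /Pdiv.Idomain.dvdpP[[c H] /= c0 cP] : Pdiv.IdomainDefs.dvdp D P by exact: dvdp_gcdl.
have [H' [D' [PE sH sD]]] := gauss_lemma c0 cP.
case: (Pirr _ _ PE) => s1.
  left; have := dvdp_gcdr P A; rewrite -/D; apply: dvdp_trans.
  rewrite -(eqp_dvdl _ (_ : D %= P)) ?dvdpp // -dvdp_size_eqp ?dvdp_gcdl //.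
  have P0 := monic_neq0 Pm.
  rewrite PE size_mul ?s1 ?sD //.
    by apply: contraNneq P0 => H0; rewrite PE H0 mul0r.
  by apply: contraNneq P0 => H0; rewrite PE H0 mulr0.
right; rewrite -(Gauss_dvdpr _ (_ : coprimep P A)) //.
by rewrite coprimep_def -/D -sD s1.
Qed.

End GaussLemma.

(** * Primality of irreducible series that are regular in the last variable *)

Section RegularPrime.
Variables (K : fieldType) (n : nat).
Local Notation R := (mpseries K n).
Local Notation S := (mpseries K n.+1).
Local Notation ser := (@series_of_poly K n).
Hypothesis irr_prime : forall p : R, irreducible_elt p -> prime_elt p.

Lemma regular_irreducible_prime d (p : S) :
  regular_order d p -> irreducible_elt p -> prime_elt p.
Proof.
move=> preg [p0 pU pI].
have [q [P [qU Pm Psz PE]]] := weierstrass_preparation preg.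
have P0 := monic_neq0 Pm.
(* Otherwise [G] has degree below [d], while [ser G] is a multiple of [p] because [ser H] is
   invertible; then [G] is 0 by uniqueness in Weierstrass division. *)
have small (G H : {poly R}) : P = G * H -> ser H \is a GRing.unit -> size H = 1%N.
  move=> PGH HU.
  have /andP[G0 H0] : (G != 0) && (H != 0) by rewrite -negb_or -mulf_eq0 -PGH.
  have [Gd|dG] := leqP (size G) d.
    case/eqP: G0; apply: (weierstrass_uniq preg (q := q / ser H) Gd).
    by rewrite mulrAC -PE PGH series_of_polyM mulrK.
  move: Psz (H0); rewrite PGH size_mul // -size_poly_gt0 => Ps Hp.
  by move: dG Ps Hp; move: (size G) (size H) => g h dG Ps Hp; lia.
have Pirr (G H : {poly R}) : P = G * H -> size G = 1%N \/ size H = 1%N.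
  move=> PGH; have /pI /orP[GU|HU] : p = (q^-1 * ser G) * ser H.
  - by rewrite -mulrA -series_of_polyM -PGH PE mulKr.
  - left; apply: (small H G); first by rewrite mulrC.
    by rewrite -(mulVKr qU (ser G)) unitrM qU.
  - by right; apply: (small G H).
have pP : divides p (ser P) by exists q.
have Pprime := monic_irreducible_prime irr_prime Pm Pirr.
move=> a b.
(* Modulo [p] both factors become polynomials in t, to which the primality of [P] applies. *)
have [qa [A [_ ->]]] := weierstrass_division preg a.
have [qb [B [_ ->]]] := weierstrass_division preg b.
move=> pab.
have dp c Q : divides P Q -> divides p (c * p + ser Q).
  move=> [Q' ->]; apply: dividesD; first by exists c.
  by rewrite series_of_polyM; apply: divides_mull.
have pAB : divides p (ser (A * B)).
  have -> : ser (A * B) = (qa * p + ser A) * (qb * p + ser B) -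
      (qa * (qb * p + ser B) + ser A * qb) * p by rewrite series_of_polyM; ring.
  by apply: dividesB => //; eexists.
have ABE := Pdiv.RingMonic.rdivp_eq Pm (A * B).
have [|/dp|/dp] := Pprime A B; [|by left|by right].
exists (Pdiv.CommonRing.rdivp (A * B) P); rewrite [LHS]ABE.
(* The remainder modulo [P] is a multiple of [p] among the series and has degree below [d], hence
   vanishes. *)
set r := Pdiv.CommonRing.rmodp _ _; suff -> : r = 0 by rewrite addr0.
have [c cE] : divides p (ser r).
  have -> : r = A * B - Pdiv.CommonRing.rdivp (A * B) P * P.
    by rewrite [X in X - _]ABE addrC addKr.
  by rewrite series_of_polyB; apply: dividesB => //; rewrite series_of_polyM; apply: divides_mull.
apply: (weierstrass_uniq preg (q := c)) => //.
by rewrite -ltnS -Psz Pdiv.CommonRing.ltn_rmodpN0.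
Qed.

End RegularPrime.

(** * Coordinate changes *)

Section Substitution.
Variables (K : fieldType) (n : nat).
Local Notation S := (mpseries K n).
Implicit Types (f g : S) (p q : {mpoly K[n]}) (s r : n.-tuple {mpoly K[n]}).

Definition low d p := forall m, (mdeg m < d)%N -> p@_m = 0.

Lemma lowM a b p q : low a p -> low b q -> low (a + b) (p * q).
Proof.
move=> pa qb m md; pose F p : S := fun m => p@_m.
rewrite (@mps_mul_trunc _ _ (a + b) (F p) (F q)) //.
by apply: (@vanishesM _ _ a b mdeg (F p) (F q)) => // k l; exact: mdegD.
Qed.

Lemma low_prod s m : (forall i, low 1 (tnth s i)) ->
  low (mdeg m) (\prod_(i < n) tnth s i ^+ m i).
Proof.
move=> s1; rewrite mdegE; elim/big_rec2: _ => [//|i p d _ dp].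
apply: lowM => //; elim: (m i) => [|k IH] //; rewrite exprS -add1n.
exact: lowM.
Qed.

Lemma low_comp s d p : (forall i, low 1 (tnth s i)) -> low d p -> low d (p \mPo s).
Proof.
move=> s1 pd k kd; rewrite comp_mpolyEX raddf_sum big1_seq //= => m _.
rewrite mcoeffZ comp_mpolyX; have [md|dm] := ltnP (mdeg m) d.
  by rewrite pd // mul0r.
by rewrite (low_prod s1) ?mulr0 //; apply: leq_trans dm.
Qed.

(** For entries of [s] without constant term, monomials of degree above [mdeg k] do not reach the
    coefficient of [k], so that truncating [f] there computes the true substitution. *)
Definition subst s f : S := fun k => (mps_trunc (mdeg k).+1 f \mPo s)@_k.

Lemma substE s d f p k : (forall i, low 1 (tnth s i)) -> (mdeg k < d)%N ->
    (forall m, (mdeg m < d)%N -> p@_m = f m) ->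
  (p \mPo s)@_k = subst s f k.
Proof.
move=> s1 kd pf; apply/eqP; rewrite -subr_eq0 /subst -mcoeffB -comp_mpolyB.
rewrite (low_comp s1 (d := (mdeg k).+1)) // => m mk.
by rewrite mcoeffB mps_truncE // pf ?subrr //; apply: leq_trans mk _.
Qed.

Lemma substM s : (forall i, low 1 (tnth s i)) -> {morph subst s : f g / f * g}.
Proof.
move=> s1 f g; apply/funext => k; set d := (mdeg k).+1.
have T h := @mps_truncE K n d h.
rewrite -(@substE s d _ (mps_trunc d f * mps_trunc d g)) //; last first.
  by move=> m md; rewrite (mps_mul_trunc (T f) (T g)).
by rewrite rmorphM /= (@mps_mul_trunc _ _ d (subst s f) (subst s g)) // => m md;
  exact: (substE s1 md (T _)).
Qed.

Lemma substK s r : (forall i, low 1 (tnth s i)) -> (forall i, low 1 (tnth r i)) ->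
  (forall i, tnth r i \mPo s = 'X_i) -> cancel (subst r) (subst s).
Proof.
move=> s1 r1 rs f; apply/funext => k; set d := (mdeg k).+1.
rewrite -(@substE s d _ (mps_trunc d f \mPo r)) //; last first.
  by move=> m md; rewrite (substE r1 md (@mps_truncE K n d f)).
rewrite -[RHS](@mps_truncE _ _ d) //; congr mcoeff; move: (mps_trunc d f) => p.
rewrite [p \mPo r]comp_mpolyEX raddf_sum [RHS]mpolyE.
apply: eq_bigr => m _ /=; rewrite comp_mpolyZ comp_mpolyX rmorph_prod /= mpolyXE_id.
by congr (_ *: _); apply: eq_bigr => i _; rewrite rmorphXn /= rs.
Qed.

End Substitution.

Section TransportAlong.
Variables (R : idomainType) (s r : R -> R).
Hypotheses (sM : {morph s : x y / x * y}) (sr : cancel r s) (rs : cancel s r).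

Lemma automorphism_inv : {morph r : x y / x * y}.
Proof. by move=> x y; rewrite -{1}(sr x) -{1}(sr y) -sM rs. Qed.

Lemma automorphism1 : s 1 = 1.
Proof. by rewrite -[LHS]mulr1 -{2}(sr 1) -sM mul1r sr. Qed.

Lemma automorphism0 : s 0 = 0.
Proof. by rewrite -[in LHS](mul0r (r 0)) sM sr mulr0. Qed.

Lemma automorphism_unit x : x \is a GRing.unit -> s x \is a GRing.unit.
Proof.
by move=> xU; apply/unitrP; exists (s x^-1); rewrite -!sM mulVr ?mulrV ?automorphism1.
Qed.

Lemma automorphism_prime p : prime_elt (s p) -> prime_elt p.
Proof.
have div x : divides (s p) (s x) -> divides p x.
  by move=> [c cE]; exists (r c); apply: (can_inj rs); rewrite sM sr.
move=> pP a b [c /(congr1 s)]; rewrite !sM => abc.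
by have [|/div|/div] := pP (s a) (s b); [exists (s c)|left|right].
Qed.

End TransportAlong.

(** Units and factorizations only involve products, so they are carried along by a multiplicative
    bijection. *)
Lemma automorphism_irreducible (R : idomainType) (s r : R -> R) p :
  {morph s : x y / x * y} -> cancel r s -> cancel s r ->
  irreducible_elt p -> irreducible_elt (s p).
Proof.
move=> sM sr rs [p0 pU pI]; have rM := automorphism_inv sM sr rs.
split.
- by apply: contraNneq p0 => sp0; rewrite -(rs p) sp0 (automorphism0 rM rs).
- by apply: contra pU => /(automorphism_unit rM rs); rewrite rs.
- move=> a b /(congr1 r); rewrite rs rM => /pI /orP[] /(automorphism_unit sM sr);
    by rewrite sr => ->; rewrite ?orbT.
Qed.

(** * Shears that make a series regular in the last variable *)

Fixpoint seq_dot (e s : seq nat) : nat :=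
  if e is a :: e' then if s is b :: s' then (a * b + seq_dot e' s')%N else 0 else 0.

Lemma seq_dotE n (e s : seq nat) : size e = n -> size s = n ->
  seq_dot e s = (\sum_(i < n) nth 0 e i * nth 0 s i)%N.
Proof.
elim: n e s => [|n IH] [|a e] [|b s] //=; first by rewrite big_ord0.
by move=> [en] [sn]; rewrite big_ord_recl /= IH.
Qed.

(* The weight of each entry exceeds the weight that the later entries
   contribute to the lexicographically least element of [Q]. *)
Lemma separating_weights n (Q : seq nat -> Prop) :
    (forall s, Q s -> size s = n.+1) -> (exists s, Q s) ->
  exists e, [/\ size e = n.+1, last 0%N e = 1%N, all (leq 1) e &
    exists2 s0, Q s0 & forall s, Q s -> s <> s0 -> (seq_dot e s0 < seq_dot e s)%N].
Proof.
elim: n Q => [|n IH] Q Qsz [s1 Qs1].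
  have Hex : exists a, `[< Q [:: a] >].
    have := Qsz _ Qs1; case: s1 Qs1 => [|a [|? ?]] // Qa _; by exists a; apply/asboolP.
  case: (ex_minnP Hex) => a /asboolP Qa min.
  exists [:: 1%N]; split=> //; exists [:: a] => // s Qs.
  have := Qsz _ Qs; case: s Qs => [|b [|? ?]] // Qb _ ne /=.
  have /min ab : `[< Q [:: b] >] by apply/asboolP.
  by have : a <> b by [move=> e; apply: ne; rewrite e]; lia.
have Hex : exists a, `[< exists s, Q (a :: s) >].
  have := Qsz _ Qs1; case: s1 Qs1 => [|a s] // Qa _.
  by exists a; apply/asboolP; exists s.
case: (ex_minnP Hex) => a /asboolP[s Qs] min.
have [||e [esz el epos [s0 Qs0 s0min]]] := IH (fun s => Q (a :: s)).
- by move=> s' /Qsz [].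
- by exists s.
exists ((seq_dot e s0).+1 :: e); split=> //=.
- by rewrite esz.
- by case: e esz el {epos s0min}.
exists (a :: s0) => // s' Qs'; have := Qsz _ Qs'; case: s' Qs' => [|b s'] // Qb _ ne /=.
have /min ab : `[< exists s, Q (b :: s) >] by apply/asboolP; exists s'.
have [e_ab|n_ab] := eqVneq a b; last by nia.
have : s' <> s0 by move=> e0; apply: ne; rewrite e0 e_ab.
by move: Qb; rewrite -e_ab => /s0min H /H; lia.
Qed.

Section Regularization.
Variables (K : fieldType) (n : nat).
Local Notation S := (mpseries K n.+1).
Implicit Types (f : S).

(** Restriction to the last coordinate axis, p(0, ..., 0, t). *)
Definition pure_hom (p : {mpoly K[n.+1]}) : {poly K} :=
  mmap (@polyC K) (fun i => if i == ord_max then 'X else 0) p.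

Lemma coef_pure_hom p j : (pure_hom p)`_j = p@_(mnmext 0%MM j).
Proof.
rewrite /pure_hom /mmap coef_sum [in RHS](mpolyE p) raddf_sum /=.
apply: eq_bigr => m _; rewrite coefCM mcoeffZ mcoeffX; congr (_ * _).
rewrite /mmap1 big_ord_recr /= eqxx.
have [m0|m0] := eqVneq (mnminit m) 0%MM.
  rewrite big1 ?mul1r ?coefXn; last first.
    move=> i _; have := congr1 (fun k : 'X_{1..n} => k i) m0.
    by rewrite mnmE mnm0E => ->; rewrite expr0.
  by rewrite -{2}(mnmext_init m) m0 eq_sym; congr (nat_of_bool _)%:R;
    apply/eqP/eqP => [->//|/(congr1 (fun k : 'X_{1..n.+1} => k ord_max))];
    rewrite !mnmext_max.
have [i mi] : exists i, mnminit m i != 0%N.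
  apply: contrapT => H; case/eqP: m0; apply/mnmP => i; rewrite mnm0E.
  by apply/eqP/contraT => mi; case: H; exists i.
rewrite (bigD1 i) //=; case: eqP => [/(congr1 val) /= ie|_].
  by have := ltn_ord i; rewrite ie ltnn.
move: mi; rewrite mnmE => mi; rewrite expr0n (negbTE mi) !mul0r coef0.
case: eqP => // mE; case/eqP: m0; by rewrite mE mnmextK.
Qed.

(** The substitution x_i |-> x_i + c t^(e_i) fixing t; the scalar [c] is there so that the inverse
    is again a shear, with - c. *)
Definition shear (c : K) (e : 'I_n.+1 -> nat) : n.+1.-tuple {mpoly K[n.+1]} :=
  [tuple if i == ord_max then 'X_i else 'X_i + c *: 'X_ord_max ^+ e i | i < n.+1].

Variable e : 'I_n.+1 -> nat.
Hypotheses (e_pos : forall i, (0 < e i)%N) (e_max : e ord_max = 1%N).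

Lemma shear_low c i : low 1 (tnth (shear c e) i).
Proof.
move=> m; rewrite ltnS leqn0 mdeg_eq0 => /eqP ->.
have X0 j : ('X_j : {mpoly K[n.+1]})@_0%MM = 0.
  rewrite mcoeffX; case: eqP => // /(congr1 mdeg).
  by rewrite mdeg1 mdeg0.
rewrite tnth_mktuple; case: eqP => _ //.
by rewrite mcoeffD mcoeffZ X0 rmorphXn /= X0 expr0n gtn_eqF ?e_pos // mulr0 addr0.
Qed.

Lemma shearK c i : tnth (shear (- c) e) i \mPo shear c e = 'X_i.
Proof.
have XE j : 'X_j \mPo shear c e = tnth (shear c e) j.
  by rewrite comp_mpolyXU -tnth_nth.
rewrite tnth_mktuple; case: eqP => [->|/eqP/negbTE ne].
  by rewrite XE tnth_mktuple eqxx.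
rewrite comp_mpolyD comp_mpolyZ rmorphXn /= !XE !tnth_mktuple eqxx ne.
by rewrite scaleNr addrK.
Qed.

(** On the axis, x_i becomes t^(e_i), also for the last variable because [e_max] gives it weight 1;
    a monomial becomes t to the power of its weight. *)
Lemma pure_hom_shear p :
  pure_hom (p \mPo shear 1 e) =
    \sum_(m <- msupp p) p@_m *: 'X^(\sum_(i < n.+1) e i * m i).
Proof.
have XE j : pure_hom 'X_j = if j == ord_max then 'X else 0.
  by rewrite /pure_hom mmapX mmap1U.
rewrite comp_mpolyEX /pure_hom raddf_sum /=; apply: eq_bigr => m _.
rewrite mmapZ /= mul_polyC comp_mpolyX rmorph_prod /=; congr (_ *: _).
rewrite (big_morph _ (exprD 'X) (expr0 'X)) /=; apply: eq_bigr => i _.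
rewrite rmorphXn /= exprM; congr (_ ^+ _); rewrite tnth_mktuple -/(pure_hom _).
case: eqP => [->|/eqP/negbTE ne]; first by rewrite XE eqxx e_max.
rewrite /pure_hom mmapD mmapZ rmorphXn /= -!/(pure_hom _) !XE ne eqxx.
by rewrite add0r mul1r.
Qed.

End Regularization.

(** With separating weights, one monomial [m0] of the support has strictly smallest weight, so on
    the axis its coefficient survives the shear without cancellation. *)
Lemma exists_regularization (K : fieldType) n (f : mpseries K n.+1) : f != 0 ->
  exists s r d, [/\ {morph s : x y / x * y :> mpseries K n.+1}, cancel s r,
    cancel r s & regular_order d (s f)].
Proof.
move=> f0.
pose sq (m : 'X_{1..n.+1}) : seq nat := m.
have sq_inj : injective sq by move=> m k /val_inj/val_inj.
have [||es [esz el epos [s0 [m0 fm0 ms0] s0min]]] :=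
    @separating_weights n (fun s => exists2 m, f m != 0 & s = sq m).
- by move=> s [m _ ->]; rewrite size_tuple.
- have [d fd] := mps_neq0_vanishes f0.
  apply: contrapT => H; apply: fd => m _; apply/eqP/contraT => fm.
  by case: H; exists (sq m), m.
pose e (i : 'I_n.+1) := nth 0%N es i.
have e_pos i : (0 < e i)%N by apply: (all_nthP _ epos); rewrite esz.
have e_max : e ord_max = 1%N by rewrite /e -el -nth_last esz.
pose w (m : 'X_{1..n.+1}) := (\sum_(i < n.+1) e i * m i)%N.
have wE m : seq_dot es (sq m) = w m.
  rewrite (@seq_dotE n.+1) ?size_tuple //; apply: eq_bigr => i _.
  by rewrite -mnm_nth.
(* The weights are positive, so truncating [f] beyond degree [w m0] keeps every monomial of weight
   at most [w m0]. *)
have wdeg m : (mdeg m <= w m)%N.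
  by rewrite mdegE; apply: leq_sum => i _; rewrite leq_pmull.
pose s := subst (shear 1 e : n.+1.-tuple {mpoly K[n.+1]}).
pose r := subst (shear (-1) e : n.+1.-tuple {mpoly K[n.+1]}).
have low1 c := @shear_low K n e e_pos c.
have sf : slice (w m0) (s f) 0%MM != 0.
  set F := mps_trunc (w m0).+1 f.
  have -> : slice (w m0) (s f) 0%MM = f m0.
    rewrite /slice /s -(@substE _ _ _ (w m0).+1 f F) //; last first.
    - by move=> m md; rewrite mps_truncE.
    - by rewrite mdeg_mnmext mdeg0.
    have m0F : F@_m0 = f m0 by rewrite mps_truncE // ltnS.
    rewrite -coef_pure_hom pure_hom_shear // coef_sum.
    rewrite (bigD1_seq m0) ?msupp_uniq ?mcoeff_msupp ?m0F //=.
    rewrite coefZ coefXn eqxx mulr1 big1_seq ?addr0 // => m /andP[ne mF].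
    rewrite coefZ coefXn -!/(w _); case: eqP => [we|]; last by rewrite mulr0.
    have md : (mdeg m < (w m0).+1)%N by rewrite ltnS we.
    move: mF; rewrite mcoeff_msupp mps_truncE // => fm.
    have := s0min (sq m); rewrite ms0 !wE we ltnn => H.
    exfalso; suff : false by []; apply: H; first by exists m.
    by move=> /sq_inj e0; rewrite e0 eqxx in ne.
  exact: fm0.
have Hex : exists d, slice d (s f) 0%MM != 0 by exists (w m0).
case: (ex_minnP Hex) => d sd min.
exists s, r, d; split.
- exact: substM.
- by apply: substK => // i; rewrite -{2}(opprK 1) shearK.
- by apply: substK => // i; rewrite shearK.
- split=> // i id; apply/eqP/contraT => /min; by rewrite leqNgt id.
Qed.

Theorem mps_irreducible_prime (K : fieldType) n (p : mpseries K n) :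
  irreducible_elt p -> prime_elt p.
Proof.
elim: n p => [|n IH] p pI; have [p0 pU _] := pI.
  (* Without variables a series is its constant term, so a nonzero one is a unit. *)
  case/negP: pU; rewrite mps_unitE; apply: contraNneq p0 => p00.
  by apply/eqP/funext => m; apply: etrans p00; congr p; apply/mnmP => -[].
have [s [r [d [sM sr rs preg]]]] := exists_regularization p0.
apply: (automorphism_prime sM rs sr).
apply: (regular_irreducible_prime IH preg).
apply: (automorphism_irreducible sM rs sr pI).
Qed.

(** * Chains of submodules between S and S_g *)

(** The ends are only bounded by [lo] and [hi], to match [has_chain], whose chains need not start at
    0 nor end at the whole module. *)
Definition chain_between (D : nzRingType) (M : lmodType D) (lo hi : {pred M}) k :=
  exists N : nat -> {pred M},
    [/\ forall i, (i <= k)%N -> submod_closed (N i),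
        forall i, (i < k)%N ->
          {subset N i <= N i.+1} /\ exists2 x, x \in N i.+1 & x \notin N i,
        {subset lo <= N 0%N} & {subset N k <= hi}].

Lemma chain_homo (D : nzRingType) (M : lmodType D) (N : nat -> {pred M}) k :
    (forall i, (i < k)%N -> {subset N i <= N i.+1}) ->
  forall i j, (i <= j <= k)%N -> {subset N i <= N j}.
Proof.
move=> Nk i j /andP[/subnKC <-]; elim: (j - i)%N => [|c IH] ik; first by rewrite addn0.
by move=> x /IH xi; rewrite addnS; apply: Nk; [|apply: xi]; lia.
Qed.

Lemma submod_closedBr (D : nzRingType) (M : lmodType D) (N : {pred M}) x y :
  submod_closed N -> x \in N -> x - y \in N -> y \in N.
Proof.
move=> [_ NZ] xN xyN; have -> : y = -1 *: (x - y) + x; last exact: NZ.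
by rewrite scaleN1r opprB subrK.
Qed.

Section LocalizationChains.
Variables (K : fieldType) (n : nat).
Local Notation S := (mpseries K n).
Local Notation D := (diffop (S : comAlgType K)).
Local Notation F := {fraction S}.
Local Notation "x %:F" := (@tofrac S x).
Implicit Types g h : S.

Lemma localization_submod h : submod_closed (localization h : {pred F}).
Proof.
split=> [|P u v uh vh]; first exact: localization0.
rewrite -[v]opprK; apply: localizationB; first exact: localizationZ.
by rewrite -[- _]sub0r localizationB ?localization0.
Qed.

Lemma set_ord1 (J : {set 'I_1}) : J = set0 \/ J = setT.
Proof.
have [J0|[i iJ]] := set_0Vmem J; [by left|right].
by apply/setP => j; rewrite inE (ord1 j) -(ord1 i).
Qed.

(** * The first local cohomology at one element, as S_g / S *)

Section FirstCohomology.
Variable g : S.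
Hypothesis g0 : g != 0.
Local Notation Z := (cocycle [tuple g] 1).
Local Notation M := {ffun {set 'I_1} -> F}.

Let prod0 : \prod_(i in (set0 : {set 'I_1})) tnth [tuple g] i = 1.
Proof. by rewrite big_set0. Qed.

Let prodT : \prod_(i in (setT : {set 'I_1})) tnth [tuple g] i = g.
Proof.
rewrite (big_pred1 ord0) ?tnth0 // => i; by rewrite inE (ord1 i) /= eqxx.
Qed.

Let T0 : (setT == set0 :> {set 'I_1}) = false.
Proof. by apply/eqP => /setP /(_ ord0); rewrite !inE. Qed.

Let card0 : (#|(set0 : {set 'I_1})| == 1%N) = false.
Proof. by rewrite cards0. Qed.

Let cardT1 : #|(setT : {set 'I_1})| == 1%N.
Proof. by rewrite cardsT card_ord. Qed.

(** With one generator the Cech differential is the inclusion of S, at index [set0], into S_g, at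
    index [setT]; no index precedes the generator, so the sign is 1. *)
Let dE (b : M) : cech_d [tuple g] b =
  [ffun J => if J == setT then b set0 else 0].
Proof.
apply/ffunP => J; rewrite !ffunE; have [->|->] := set_ord1 J.
  by rewrite prod0 oner_eq0 big_set0 eq_sym T0.
rewrite prodT (negbTE g0) eqxx (big_pred1 ord0); last first.
  by move=> i; rewrite inE (ord1 i) /= eqxx.
have -> : [set k : 'I_1 in setT | (k < (ord0 : 'I_1))%N] = set0.
  by apply/setP => k; rewrite !inE ltn0.
rewrite cards0 expr0 mul1r; congr (b _).
by apply/setP => k; rewrite !inE (ord1 k) eqxx.
Qed.

Definition cochain_of (y : F) : M := [ffun J => if J == setT then y else 0].

Lemma cochain_of_cocycle y : y \in localization g ->
  cochain_of y \in cech_cocycle [tuple g] 1.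
Proof.
move=> yg; apply/andP; split.
  apply/forallP => J; rewrite ffunE; have [->|->] := set_ord1 J.
    by rewrite card0 [set0 == _]eq_sym T0.
  by rewrite cardT1 eqxx prodT.
rewrite dE; apply/eqP/ffunP => J; rewrite !ffunE [set0 == _]eq_sym T0.
by rewrite if_same.
Qed.

(** Meaningful for [y] in S_g only; elsewhere [insubd] may return the default 0. *)
Definition cocycle_of (y : F) : Z := insubd 0 (cochain_of y).

Lemma cocycle_ofE y : y \in localization g -> val (cocycle_of y) = cochain_of y.
Proof. by move=> yg; rewrite val_insubd cochain_of_cocycle. Qed.

Lemma cocycle_of_linear a x y : x \in localization g -> y \in localization g ->
  cocycle_of (a *: x + y) = a *: cocycle_of x + cocycle_of y.
Proof.
move=> xg yg; apply: val_inj; rewrite cocycle_ofE; last first.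
  by have [_ ->] := localization_submod g.
rewrite -[RHS]/(a *: val (cocycle_of x) + val (cocycle_of y)) !cocycle_ofE //.
by apply/ffunP => J; rewrite !ffunE; case: ifP => // _; rewrite scaler0 addr0.
Qed.

Lemma cocycle_ofP (c : Z) : exists2 y, y \in localization g & c = cocycle_of y.
Proof.
have cZ := valP c; have /andP[/forallP cC _] := cZ.
have cT : val c setT \in localization g by have := cC setT; rewrite cardT1 prodT.
exists (val c setT) => //; apply: val_inj; rewrite cocycle_ofE //.
apply/ffunP => J; rewrite ffunE; have [->|->] := set_ord1 J; last by rewrite ifT.
by have := cC set0; rewrite card0 [set0 == _]eq_sym T0 => /eqP.
Qed.

(** A coboundary comes from a component at [set0], where the empty product makes the localization S
    itself, written [localization 1]. *)
Lemma cocycle_of_coboundary y : y \in localization g ->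
  (cocycle_of y \in coboundary (g := [tuple g]) (j := 1)) = (y \in localization 1).
Proof.
move=> yg; rewrite -[LHS]/(val (cocycle_of y) \in cech_coboundary [tuple g] 1).
rewrite cocycle_ofE //; apply/asboolP/idP => [[b bC]|y1].
  move=> /(congr1 (fun c : M => c setT)); rewrite dE !ffunE eqxx => ->.
  by have := forallP bC set0; rewrite cards0 eqxx prod0.
exists [ffun J => if J == set0 then y else 0].
  apply/forallP => J; rewrite ffunE; have [->|->] := set_ord1 J.
    by rewrite cards0 !eqxx prod0.
  by rewrite T0 cardsT card_ord /=.
by rewrite dE; apply/ffunP => J; rewrite !ffunE eqxx.
Qed.

Local Notation H1 := (local_cohomology [tuple g] 1).

Definition class_of (y : F) : H1 :=
  (\pi_(quotmod (@coboundary K n 1 [tuple g] 1)) (cocycle_of y))%qT.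

Lemma class_of_linear a x y : x \in localization g -> y \in localization g ->
  class_of (a *: x + y) = a *: class_of x + class_of y.
Proof.
move=> xg yg; rewrite /class_of cocycle_of_linear // quotmod_piD.
by congr (_ + _); rewrite -[RHS]/(quotmod_scale _ _) quotmod_scale_pi.
Qed.

Lemma class_ofP (x : H1) : exists2 y, y \in localization g & x = class_of y.
Proof.
by elim/quotW: x => c; have [y yg ->] := cocycle_ofP c; exists y.
Qed.

Lemma class_of_eq x y : x \in localization g -> y \in localization g ->
  class_of x = class_of y <-> y - x \in localization 1.
Proof.
move=> xg yg; rewrite -cocycle_of_coboundary; last exact: localizationB.
have -> : y - x = -1 *: x + y by rewrite scaleN1r addrC.
rewrite cocycle_of_linear // scaleN1r addrC.
by split=> [/esym/quotmod_eq|/quotmod_eq/esym].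
Qed.

Lemma class_of0 : class_of 0 = 0.
Proof.
have l0 := localization0 g.
by have := class_of_linear (-1) l0 l0; rewrite scaler0 addr0 scaleN1r addNr.
Qed.

(** The correspondence between submodules of S_g / S and submodules of S_g containing S, by preimage
    and image under [class_of]. *)
Lemma has_chain_localization k : has_chain H1 k <->
  chain_between (localization 1 : {pred F}) (localization g) k.
Proof.
have [Lg0 LgZ] := localization_submod g.
have S_loc : {subset localization 1 <= (localization g : {pred F})}.
  by move=> y /localizationP[a [j ->]]; rewrite tofrac1 expr1n divr1 localization_frac.
split=> [[N [Ncl Nst]]|[N [Ncl Nst loN Nhi]]].
  pose N' i : {pred F} := fun y => (y \in localization g) && (class_of y \in N i).
  have N'E i y : (y \in N' i) = (y \in localization g) && (class_of y \in N i) by [].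
  exists N'; split.
  - move=> i ik; have [N0 NZ] := Ncl i ik; split=> [|a u v].
      by rewrite N'E Lg0 class_of0.
    rewrite !N'E => /andP[ug uN] /andP[vg vN].
    by rewrite LgZ // class_of_linear // NZ.
  - move=> i ik; have [sub [x xN xNN]] := Nst i ik; split=> [y|].
      by rewrite !N'E => /andP[-> /sub].
    by have [y yg xE] := class_ofP x; exists y; rewrite N'E yg -xE.
  - move=> y y1; have yg := S_loc y y1; rewrite N'E yg.
    have [N0 _] := Ncl 0%N isT; suff -> : class_of y = 0 by [].
    by rewrite -class_of0; apply/class_of_eq => //;
      rewrite sub0r -sub0r localizationB ?localization0.
  - by move=> y; rewrite N'E => /andP[].
have Nsub := chain_homo (fun i ik => (Nst i ik).1).
have Ng i y : (i <= k)%N -> y \in N i -> y \in localization g.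
  by move=> ik yN; apply/Nhi/(Nsub i k); rewrite ?ik /=.
exists (fun i x => `[< exists2 y, y \in N i & x = class_of y >]); split.
- move=> i ik; have [N0 NZ] := Ncl i ik; split=> [|a u v].
    by apply/asboolP; exists 0; rewrite ?class_of0.
  move=> /asboolP[x xN ->] /asboolP[y yN ->]; apply/asboolP.
  by exists (a *: x + y); [exact: NZ|rewrite class_of_linear ?(Ng i)].
- move=> i ik; have [sub [y yN yNN]] := Nst i ik; split=> [x|].
    by move=> /asboolP[z zN ->]; apply/asboolP; exists z => //; apply: sub.
  exists (class_of y); first by apply/asboolP; exists y.
  apply/asboolP => -[z zN]; have ik' := ltnW ik.
  (* Elements with the same class differ by an element of S, which lies in every [N i]; this keeps
     the inclusions strict. *)
  move=> /(class_of_eq (Ng _ _ ik yN) (Ng _ _ ik' zN)) yz; case/negP: yNN.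
  apply: (submod_closedBr (Ncl i ik') zN).
  by apply: (Nsub 0%N i); [rewrite ik'|exact: loN].
Qed.

End FirstCohomology.
End LocalizationChains.

(** * Coprime elements *)

(** Multiplication by [h] is injective modulo [g]. This form of coprimality passes to products on
    either side, which is what powers and products of irreducibles require. *)
Definition regular_mod (R : comNzRingType) (g h : R) :=
  forall a, divides g (a * h) -> divides g a.

Section RegularMod.
Variable R : idomainType.
Implicit Types g h : R.

Lemma regular_mod1r g : regular_mod g 1.
Proof. by move=> a; rewrite mulr1. Qed.

Lemma regular_mod1l h : regular_mod 1 h.
Proof. by move=> a _; exists a; rewrite mulr1. Qed.

Lemma regular_modMr g h h' :
  regular_mod g h -> regular_mod g h' -> regular_mod g (h * h').
Proof. by move=> gh gh' a; rewrite mulrA => /gh' /gh. Qed.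

Lemma regular_modMl g g' h : g != 0 ->
  regular_mod g h -> regular_mod g' h -> regular_mod (g * g') h.
Proof.
move=> g0 gh g'h a [b abE]; have [|c ac] := gh a.
  by exists (b * g'); rewrite abE -mulrA (mulrC g').
have [|e ce] := g'h c.
  by exists b; apply: (mulIf g0); rewrite mulrAC -ac abE; ring.
by exists e; rewrite ac ce -mulrA (mulrC g').
Qed.

Lemma regular_modX g h j k : g != 0 -> regular_mod g h -> regular_mod (g ^+ j) (h ^+ k).
Proof.
move=> g0 gh; elim: k => [|k IH]; first exact: regular_mod1r.
rewrite exprS; apply: regular_modMr => //.
elim: j {IH} => [|j IHj]; first exact: regular_mod1l.
by rewrite exprS; apply: regular_modMl.
Qed.

Lemma regular_mod_irreducible g h : irreducible_elt g -> irreducible_elt h ->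
  prime_elt g -> ~ associated g h -> regular_mod g h.
Proof.
move=> [_ gU _] [_ _ hI] gP gh a /gP[//|[c hE]].
by have /orP[cU|/(negP gU)//] := hI _ _ hE; case: gh; exists c.
Qed.

End RegularMod.

(** * Gluing chains for coprime elements *)

Section Gluing.
Variables (K : fieldType) (n : nat).
Local Notation S := (mpseries K n).
Local Notation F := {fraction S}.
Local Notation "x %:F" := (@tofrac S x).
Implicit Types g h : S.

Lemma localization_mul g h : h != 0 ->
  {subset localization g <= (localization (g * h) : {pred F})}.
Proof.
move=> h0 _ /localizationP[a [k ->]]; apply/localizationP.
exists (a * h ^+ k.+1), k; rewrite !tofracM !tofracXn exprMn -mulf_div divff ?mulr1 //.
by rewrite expf_neq0 // tofrac_eq0.
Qed.

(** This is why the exponents of the irreducible factors do not affect the bound. *)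
Lemma localizationX g j : g != 0 ->
  localization (g ^+ j.+1) =i (localization g : {pred F}).
Proof.
move=> g0 y; apply/idP/idP; last by rewrite exprS; apply/localization_mul/expf_neq0.
move=> /localizationP[a [k ->]]; apply/localizationP.
(* The predecessor offsets the successor that [localization] puts on its exponent. *)
by exists a, (j.+1 * k.+1).-1; rewrite prednK // tofracXn exprM.
Qed.

(** If a / g^(k+1) = b / h^(l+1), then g^(k+1) divides a h^(l+1), hence a. *)
Lemma localizationI g h y : g != 0 -> h != 0 -> regular_mod g h ->
  y \in localization g -> y \in localization h -> y \in (localization 1 : {pred F}).
Proof.
move=> g0 h0 gh /localizationP[a [k yE]] /localizationP[b [l]].
have gk : g%:F ^+ k.+1 != 0 by rewrite expf_neq0 // tofrac_eq0.
have hl : h%:F ^+ l.+1 != 0 by rewrite expf_neq0 // tofrac_eq0.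
rewrite yE => /eqP; rewrite eqr_div // -!tofracXn -!tofracM tofrac_eq => /eqP ab.
have [|c ->] := regular_modX (j := k.+1) (k := l.+1) g0 gh (a := a); first by exists b.
by rewrite tofracM mulfK ?tofracXn // localization_frac ?oner_neq0.
Qed.

(* [1 / (g h)] lies in [S_g + S_h] only if [g] and [h] generate the unit
   ideal, which is excluded because [S] is local. *)
Lemma localization_sum_proper g h y z : g != 0 -> h != 0 ->
    g \isn't a GRing.unit -> h \isn't a GRing.unit ->
    regular_mod g h -> regular_mod h g ->
  y \in localization g -> z \in localization h -> y + z <> (g * h)%:F^-1.
Proof.
move=> g0 h0 gU hU gh hg /localizationP[a [k ->]] /localizationP[b [l ->]].
have gk j : g%:F ^+ j != 0 by rewrite expf_neq0 // tofrac_eq0.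
have hl j : h%:F ^+ j != 0 by rewrite expf_neq0 // tofrac_eq0.
rewrite addf_div // -[RHS]mul1r => /eqP.
have gh0 : (g * h)%:F != 0 by rewrite tofrac_eq0 mulf_neq0.
rewrite eqr_div ?mulf_neq0 // mul1r -!tofracXn -!tofracM -tofracD -tofracM.
rewrite tofrac_eq => /eqP E.
have {}E : a * h ^+ l.+1 + b * g ^+ k.+1 = g ^+ k * h ^+ l.
  by apply: (mulIf (mulf_neq0 g0 h0)); rewrite E !exprS; ring.
(* By [E] and coprimality, g^k divides [a] and h^l divides [b]; cancelling g^k h^l then writes 1 as
   a combination of [g] and [h]. *)
have [|a' aE] := regular_modX (j := k) (k := l.+1) g0 gh (a := a).
  exists (h ^+ l - b * g); rewrite mulrBl -[LHS](addrK (b * g ^+ k.+1)) E exprS; ring.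
have [|b' bE] := regular_modX (j := l) (k := k.+1) h0 hg (a := b).
  exists (g ^+ k - a * h); rewrite mulrBl -[LHS](addKr (a * h ^+ l.+1)) E exprS; ring.
have /eqP := mps_nonunit_comb b' a' gU hU; apply.
apply: (mulIf (mulf_neq0 (expf_neq0 k g0) (expf_neq0 l h0))).
by rewrite mul1r -[RHS]E aE bE !exprS; ring.
Qed.

Lemma chain_between_glue g h j k : g != 0 -> h != 0 ->
    g \isn't a GRing.unit -> h \isn't a GRing.unit ->
    regular_mod g h -> regular_mod h g ->
    chain_between (localization 1 : {pred F}) (localization g) j ->
    chain_between (localization 1 : {pred F}) (localization h) k ->
  chain_between (localization 1 : {pred F}) (localization (g * h)) (j + k).+1.
Proof.
move=> g0 h0 gU hU gh hg [N [Ncl Nst loN Nhi]] [L [Lcl Lst loL Lhi]].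
have Nsub := chain_homo (fun i ij => (Nst i ij).1).
have Lsub := chain_homo (fun i ik => (Lst i ik).1).
pose G i : {pred F} := fun y =>
  `[< exists u v, [/\ u \in localization g, v \in L i & y = u + v] >].
have Gcl i : (i <= k)%N -> submod_closed (G i).
  move=> ik; have [g0' gZ] := localization_submod g; have [L0 LZ] := Lcl i ik.
  split=> [|a x y]; first by apply/asboolP; exists 0, 0; rewrite addr0.
  move=> /asboolP[u [v [ug vL ->]]] /asboolP[u' [v' [ug' vL' ->]]]; apply/asboolP.
  exists (a *: u + u'), (a *: v + v'); split; [exact: gZ|exact: LZ|].
  by rewrite scalerDr addrACA.
have gG i y : (i <= k)%N -> y \in localization g -> y \in G i.
  move=> ik yg; apply/asboolP; exists y, 0; rewrite addr0.
  by have [L0 _] := Lcl i ik.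
have Gh i y : (i <= k)%N -> y \in G i -> exists u v,
    [/\ u \in localization g, v \in localization h & y = u + v].
  move=> ik /asboolP[u [v [ug vL ->]]]; exists u, v; split=> //.
  by apply/Lhi/(Lsub i k) => //; rewrite ik leqnn.
(* The term [N j] is replaced by [G 0], which contains S_g. There remain j terms of [N], k + 1 terms
   of [G] and S_gh, hence j + k + 1 steps. *)
pose C i : {pred F} := if (i < j)%N then N i
  else if (i <= j + k)%N then G (i - j)%N else localization (g * h).
have C1 i : (i < j)%N -> C i = N i by rewrite /C => ->.
have C2 i : (i <= k)%N -> C (j + i)%N = G i.
  by move=> ik; rewrite /C ltnNge leq_addr leq_add2l ik /= addKn.
have C3 : C (j + k).+1 = localization (g * h).
  by rewrite /C ltnNge leqW ?leq_addr // ltnn.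
have Ccase i : (i < j)%N \/ exists2 e, i = (j + e)%N & (j <= i)%N.
  by case: (ltnP i j) => ij; [left|right; exists (i - j)%N => //; rewrite subnKC].
exists C; split.
- move=> i ijk; case: (Ccase i) => [ij|[e iE _]].
    by rewrite C1 //; apply/Ncl/ltnW.
  rewrite iE.
  have [ek|ke] := leqP e k; first by rewrite C2 //; apply: Gcl.
  have -> : e = k.+1 by lia.
  by rewrite addnS C3; apply: localization_submod.
- move=> i ijk; case: (Ccase i) => [ij|[e iE _]].
    rewrite (C1 i) //; have [sub [x xN xNN]] := Nst i ij.
    have [ij1|ji1] := ltnP i.+1 j; first by rewrite C1 //; split=> //; exists x.
    have NG y : y \in N i.+1 -> y \in C i.+1.
      have ej : i.+1 = j by apply/eqP; rewrite eqn_leq ij ji1.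
      by move=> yN; rewrite ej -[j]addn0 C2 //; apply: gG => //; apply: Nhi; rewrite -ej.
    by split=> [y /sub /NG|] //; exists x => //; apply: NG.
  have ek : (e <= k)%N by move: ijk; rewrite iE ltnS leq_add2l.
  have [ek1|ke] := ltnP e k; last first.
    have ee : e = k by apply/eqP; rewrite eqn_leq ek ke.
    rewrite iE ee C3 C2 //; split=> [y /(Gh _ _ (leqnn k))[u [v [ug vh ->]]]|].
      have [_ ghZ] := localization_submod (g * h).
      rewrite -[u]scale1r; apply: ghZ; first exact: localization_mul.
      by rewrite mulrC; apply: localization_mul.
    exists (g * h)%:F^-1; last first.
      apply/negP => /(Gh _ _ (leqnn k))[u [v [ug vh]]] /esym.
      exact: localization_sum_proper.
    apply/localizationP; exists (g * h), 1%N.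
    by rewrite expr2 invfM mulrA divff ?mul1r // tofrac_eq0 mulf_neq0.
  rewrite iE -addnS !C2 //; have [sub [x xL xNL]] := Lst e ek1; split=> [y|].
    move=> /asboolP[u [v [ug vL ->]]]; apply/asboolP.
    by exists u, v; split=> //; apply: sub.
  exists x; first by apply/asboolP; exists 0, x; rewrite localization0 add0r.
  (* If x = u + v with u in S_g and v in [L e], then u = x - v also lies in S_h, hence in S and in
     [L e]; this would put x in [L e]. *)
  apply/asboolP => -[u [v [ug vL xE]]]; case/negP: xNL.
  have [_ LZ] := Lcl e ek; rewrite xE -[u]scale1r; apply: LZ => //.
  apply: (Lsub 0%N e) => //; apply: loL; apply: (localizationI g0 h0 gh ug).
  have -> : u = x - v by rewrite xE addrK.
  apply: localizationB; apply: Lhi; [apply: (Lsub e.+1 k)|apply: (Lsub e k)] => //.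
    by rewrite ek1 leqnn.
  by rewrite ek leqnn.
- move=> y y1; have yg : y \in localization g.
    by have := localization_mul g0 y1; rewrite mul1r.
  (* For [j] = 0 the glued chain starts with [G 0], which contains S through S_g. *)
  case: (posnP j) => [j0|j0]; last by rewrite C1 //; apply: loN.
  by have := C2 0%N isT; rewrite j0 => ->; apply: gG.
- by rewrite C3.
Qed.

End Gluing.

(** * Lengths and the final inequality *)

Section ModuleLength.
Variables (D : nzRingType) (M : lmodType D).

Lemma module_length_bounded b : (forall k, has_chain M k -> (k <= b)%N) ->
  exists2 k, has_chain M k & module_length M = k%:Z%:E.
Proof.
move=> Mb; rewrite /module_length; case: pselect => [bd|[]]; last first.
  by exists b => k /asboolP /Mb.
by case: ex_maxnP => k /asboolP kM _; exists k.
Qed.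

Lemma module_length_max : module_length M = +oo%E \/
  exists2 l, module_length M = l%:Z%:E & forall k, has_chain M k -> (k <= l)%N.
Proof.
rewrite /module_length; case: pselect => [bd|]; [right|by left].
by case: ex_maxnP => l _ lmax; exists l => // k /asboolP /lmax.
Qed.

End ModuleLength.

Section ChainProduct.
Variables (K : fieldType) (n : nat).
Local Notation S := (mpseries K n).
Local Notation F := {fraction S}.
Local Notation chain g k :=
  (chain_between (localization 1 : {pred F}) (localization g) k).

Lemma chain_between_prod l (g : 'I_l.+1 -> S) (k : 'I_l.+1 -> nat) :
    (forall i, g i != 0) -> (forall i, g i \isn't a GRing.unit) ->
    (forall i j, i != j -> regular_mod (g i) (g j)) ->
    (forall i, chain (g i) (k i)) ->
  chain (\prod_(i < l.+1) g i) (\sum_(i < l.+1) k i + l).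
Proof.
elim: l g k => [|l IH] g k g0 gU greg gk.
  by rewrite !big_ord1 addn0.
pose w := widen_ord (leqnSn l.+1).
have wmax i : w i != ord_max by rewrite -val_eqE /= ltn_eqF.
rewrite [\prod_(i < _) _]big_ord_recr
  [(\sum_(i < _) _)%N]big_ord_recr /= -/w addnS addnAC.
have prod0 : \prod_(i < l.+1) g (w i) != 0 by apply/prodf_neq0 => i _.
apply: chain_between_glue => //.
- rewrite big_ord_recr /= unitrM negb_and; apply/orP; right; exact: gU.
(* [regular_modMl] asks for a nonzero first factor, so the induction carries the nonvanishing of the
   partial products. *)
- elim/big_ind: _ (prod0) => [_|x y IHx IHy|i _ _]; [exact: regular_mod1l| |exact: greg].
  by rewrite mulf_eq0 negb_or => /andP[x0 y0]; apply: regular_modMl; auto.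
- elim/big_ind: _ => [|x y|i _]; [exact: regular_mod1r|exact: regular_modMr|].
  by apply: greg; rewrite eq_sym.
- apply: IH => // i j ij; apply: greg; apply: contraNneq ij => /(congr1 val) /= e.
  exact/eqP/val_inj.
Qed.

End ChainProduct.

Theorem proposition4p12 (K : fieldType) (n l : nat)
    (f_ : 'I_l -> mpseries K n) (alpha : 'I_l -> nat) (f : mpseries K n)
    (l_gt0 : (0 < l)%N)
    (f_irr : forall i, irreducible_elt (f_ i))
    (f_nassoc : forall i j, i != j -> ~ associated (f_ i) (f_ j))
    (alpha_gt0 : forall i, (0 < alpha i)%N)
    (fE : f = \prod_(i < l) f_ i ^+ alpha i) :
  (\sum_(i < l) lyubeznik0 [tuple f_ i] n.-1 + (l%:Z - 1)%:E
     <= lyubeznik0 [tuple f] n.-1)%E.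
Proof.
case: l l_gt0 f_ alpha f_irr f_nassoc alpha_gt0 fE => // l _ f_ alpha
  f_irr f_nassoc alpha_gt0 fE.
have fi0 i : f_ i != 0 by case: (f_irr i).
have fiU i : f_ i \isn't a GRing.unit by case: (f_irr i).
(* Without variables there is no irreducible element; from here on [n.-1] is a true predecessor and
   the cohomological degree is 1. *)
case: n f_ f fi0 fiU f_irr f_nassoc fE => [|n] f_ f fi0 fiU f_irr f_nassoc fE.
  case/eqP: (fi0 ord0); apply/funext => m.
  have := fiU ord0; rewrite mps_unitE negbK => /eqP; apply: etrans.
  by congr (f_ _ _); apply/mnmP => -[].
rewrite /lyubeznik0 leqnSn subSnn.
have gi0 i : f_ i ^+ alpha i != 0 by rewrite expf_neq0.
have f0 : f != 0 by rewrite fE; apply/prodf_neq0 => i _.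
have chain_f (k : 'I_l.+1 -> nat) :
    (forall i, has_chain (local_cohomology [tuple f_ i] 1) (k i)) ->
  has_chain (local_cohomology [tuple f] 1) (\sum_(i < l.+1) k i + l).
  move=> fk; apply/(has_chain_localization f0); rewrite fE.
  apply: chain_between_prod => // [i|i j ij|i].
  - by rewrite -(prednK (alpha_gt0 i)) exprS unitrM negb_and fiU.
  - apply: regular_modX => //; apply: regular_mod_irreducible => //.
      exact: mps_irreducible_prime.
    exact: f_nassoc.
  - have [N [Ncl Nst loN Nhi]] := (has_chain_localization (fi0 i) (k i)).1 (fk i).
    exists N; split=> // x /Nhi; by rewrite -(prednK (alpha_gt0 i)) localizationX.
(* If the length for [f] is infinite the inequality is clear; otherwise it is a bound [b] on its
   chains. *)
have [->|[b -> fb]] := module_length_max (local_cohomology [tuple f] 1).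
  exact: leey.
have zero_chain i : has_chain (local_cohomology [tuple f_ i] 1) 0.
  by have [k /asboolP] := has_chain0 (local_cohomology [tuple f_ i] 1);
     move=> [N [Ncl _]]; exists N; split=> // j; rewrite leqn0 => /eqP ->; apply: Ncl.
(* A chain for one factor, glued with chains of length 0 for the others, has at most [b] steps. So
   the length for every factor is finite and attained by a chain. *)
have bounded i k : has_chain (local_cohomology [tuple f_ i] 1) k -> (k <= b)%N.
  move=> ki; apply: leq_trans (fb _ (chain_f (fun j => if j == i then k else 0%N) _)).
    by rewrite (bigD1 i) //= eqxx -addnA leq_addr.
  by move=> j; case: (j =P i) => [->|_].
have [k kE] := choice (fun i =>
  let: ex_intro2 k hk lk := module_length_bounded (bounded i) in
  ex_intro _ k (conj hk lk)).
rewrite (eq_bigr (fun i => (k i)%:Z%:E)) => [|i _]; last by case: (kE i).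
rewrite sumEFin -EFinD lee_fin.
have := fb _ (chain_f k (fun i => (kE i).1)); rewrite -lez_nat; apply: le_trans.
by rewrite PoszD (big_morph Posz PoszD (erefl _)) intS addrAC subrr add0r.
Qed.
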